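(* Let $M$ be a positive monoid consisting of algebraic numbers, and let $E(M) = \langle e^m \mid m \in M \rangle$ be its exponentiation semiring. Then the following statements hold. (1) If $M$ satisfies the ACCP, then $E(M)$ satisfies the ACCP. (2) If $M$ is a bounded factorization monoid (BFM), then $E(M)$ is a bounded factorization semiring (BFS). (3) If $M$ is a finite factorization monoid (FFM), then $E(M)$ is a finite factorization semiring (FFS).
   Context: A positive monoid is an additive submonoid of $\mathbb{R}_{\ge 0}$. For a positive monoid $M$, $E(M) = \langle e^m \mid m \in M\rangle$ denotes the additive submonoid of $\mathbb{R}_{\ge 0}$ generated by $\{e^m \mid m \in M\}$, where $e$ is the base of the natural logarithm; it contains $1$ and is closed under multiplication, so it is a subsemiring of $\mathbb{R}_{\ge 0}$. $E(M)^\bullet = E(M)\setminus\{0\}$ is viewed as a monoid under multiplication. $E(M)$ is said to satisfy the ACCP (resp. to be a BFS, an FFS) if the multiplicative monoid $E(M)^\bullet$ satisfies the ACCP (resp. is a BFM, an FFM). The properties of $M$ refer to its addition. Let $H$ be a cancellative commutative monoid, written additively; here $H$ is $(M,+)$ or $(E(M)^\bullet,\cdot)$ and, in both cases, $H$ is reduced, i.e., the identity is its only invertible element. A principal ideal of $H$ is a set $b + H$ with $b \in H$; $H$ satisfies the ACCP (ascending chain condition on principal ideals) if every sequence $(I_n)_{n\ge 1}$ of principal ideals with $I_n \subseteq I_{n+1}$ for all $n$ is eventually constant. An atom of $H$ is a non-invertible element $a$ such that $a = b + c$ with $b,c \in H$ implies that $b$ or $c$ is invertible. $\mathsf{Z}(H)$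 is the free commutative monoid on the set of atoms of $H$ (finite multisets of atoms), $\pi: \mathsf{Z}(H) \to H$ is the monoid homomorphism fixing each atom, and for $b \in H$, $\mathsf{Z}(b) = \{z \in \mathsf{Z}(H) \mid \pi(z) = b\}$. The length $|z|$ of $z \in \mathsf{Z}(H)$ is the number of atoms in $z$ counted with repetitions, and $\mathsf{L}(b) = \{|z| \mid z \in \mathsf{Z}(b)\}$. $H$ is a BFM if $1 \le |\mathsf{L}(b)| < \infty$ for every $b \in H$, and an FFM if $1 \le |\mathsf{Z}(b)| < \infty$ for every $b \in H$. *)

(* Defs.v *)
From mathcomp Require Import all_boot all_order all_algebra.
From mathcomp Require Import finmap multiset.
From mathcomp Require Import all_classical all_reals all_analysis.

Set Implicit Arguments.
Unset Strict Implicit.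
Unset Printing Implicit Defensive.

Import Order.TTheory GRing.Theory Num.Theory.

Local Open Scope classical_set_scope.
Local Open Scope ring_scope.

(* Divisibility theory of a commutative monoid, given as a submonoid [H] of an
   ambient commutative monoid law [op] on [T] with identity [idx].  Using a
   subset and a law (rather than an algebraic structure on a type) lets the same
   definitions apply to the additive monoid [M] and to the multiplicative monoid
   of nonzero elements of the semiring [E(M)], both inside the real numbers. *)

Definition submonoid (T : Type) (idx : T) (op : Monoid.com_law idx)
    (H : set T) : Prop :=
  H idx /\ forall x y, H x -> H y -> H (op x y).

Definition invertible (T : Type) (idx : T) (op : Monoid.com_law idx)
    (H : set T) (u : T) : Prop :=
  H u /\ exists2 v, H v & op u v = idx.

Definition principal_ideal (T : Type) (idx : T) (op : Monoid.com_law idx)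
    (H : set T) (b : T) : set T :=
  [set op b c | c in H].

Definition ACCP (T : Type) (idx : T) (op : Monoid.com_law idx)
    (H : set T) : Prop :=
  forall I : nat -> set T,
    (forall n, exists2 b, H b & I n = principal_ideal op H b) ->
    (forall n, I n `<=` I n.+1) ->
    exists N, forall n, (N <= n)%N -> I n = I N.

Definition atom (T : Type) (idx : T) (op : Monoid.com_law idx)
    (H : set T) (a : T) : Prop :=
  [/\ H a, ~ invertible op H a &
      forall b c, H b -> H c -> a = op b c ->
        invertible op H b \/ invertible op H c].

(* [Z(b)]: the finite multisets of atoms whose product is [b].  As in the
   definition of factorizations as multisets of atoms themselves (and not of
   associate classes of atoms), [H] is meant to be reduced. *)
Definition factorizations (T : choiceType) (idx : T) (op : Monoid.com_law idx)
    (H : set T) (b : T) : set (multiset T) :=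
  [set z : multiset T | (forall a, a \in z -> atom op H a) /\
                        \big[op/idx]_(a <- z) a = b].

(* [L(b)]; [size] is that of the enumeration of the multiset with repetitions. *)
Definition lengths (T : choiceType) (idx : T) (op : Monoid.com_law idx)
    (H : set T) (b : T) : set nat :=
  [set size z | z in factorizations op H b].

Definition BFM (T : choiceType) (idx : T) (op : Monoid.com_law idx)
    (H : set T) : Prop :=
  forall b, H b -> lengths op H b !=set0 /\ finite_set (lengths op H b).

Definition FFM (T : choiceType) (idx : T) (op : Monoid.com_law idx)
    (H : set T) : Prop :=
  forall b, H b ->
    factorizations op H b !=set0 /\ finite_set (factorizations op H b).

Definition positive_monoid (R : realType) (M : set R) : Prop :=
  @submonoid R 0 +%R M /\ M `<=` [set x | 0 <= x].

Definition algebraic_number (R : realType) (x : R) : Prop :=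
  algebraicOver (@ratr R) x.

Definition exp_semiring (R : realType) (M : set R) : set R :=
  smallest (@positive_monoid R) [set expR m | m in M].

(* The properties of a subsemiring [S] of the nonnegative reals are those of the
   multiplicative monoid [S] minus zero. *)

Definition semiring_ACCP (R : realType) (S : set R) : Prop :=
  @ACCP R 1 *%R (S `\ 0).

Definition BFS (R : realType) (S : set R) : Prop :=
  @BFM R 1 *%R (S `\ 0).

Definition FFS (R : realType) (S : set R) : Prop :=
  @FFM R 1 *%R (S `\ 0).

(* Main.v *)
Require Import Defs.
From HB Require Import structures.
From mathcomp Require Import all_boot all_order all_fingroup all_algebra.
From mathcomp Require Import finmap multiset separable complex.
From mathcomp Require Import all_classical all_reals all_analysis.
From mathcomp Require Import ring lra zify.
From mathcomp Require mpoly.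

Set Implicit Arguments.
Unset Strict Implicit.
Unset Printing Implicit Defensive.

Import Order.TTheory GRing.Theory Num.Theory.
Import numFieldNormedType.Exports.

Local Open Scope classical_set_scope.
Local Open Scope ring_scope.

(** The exponentials of distinct real algebraic numbers are linearly
    independent over the integers ([exp_lin_indep], the real case of the
    Lindemann-Weierstrass theorem).  Hence an element of E(M) is the sum of the
    exponentials of a multiset of exponents in M which it determines, and a
    product of two elements has as exponents all the sums of an exponent of the
    one and an exponent of the other.  So the largest exponent is additive, the
    number of exponents is multiplicative, and 1 is the only nonzero element
    with largest exponent 0 and a single exponent.  Sending an element to this
    pair is therefore a homomorphism from the nonzero elements of E(M) to the
    product of (M, +) and the positive integers under multiplication that takes
    only 1 to the identity.  Along an ascending chain of principal ideals both
    coordinates stabilise as soon as M satisfies the ACCP, and then so does the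
    chain; and a bound on the number of nonzero summands in M of the largest
    exponent, together with the number of exponents, bounds the number of
    factors different from 1.  For the FFM property, each exponent of a divisor
    of b divides in M an exponent of b, so that b has finitely many divisors
    when the elements of M do; with the bound on lengths, finitely many
    factorizations remain.

    The independence of exponentials is proved by contradiction from a relation
    between exponentials of algebraic numbers.  Up to a common denominator l,
    these are among the roots rho_0, ..., rho_(d-1) of a separable monic integer
    polynomial.  Multiplying the relations obtained by permuting the roots in
    all possible ways yields sum_phi b_phi e^(delta_phi / l) = 0, and now the
    numbers T(q) = sum_phi b_phi q(delta_phi), for q an integer polynomial,
    depend symmetrically on the roots.  They are thus integers
    ([SymmetricValues.conj_trace_int]), they satisfy T(q)^p = T(q^p) modulo
    every prime p ([SymmetricValues.conj_trace_exp_prime]), and T vanishes on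
    the multiples of some G in Z[X] without repeated roots.

    Hermite's argument needs only this functional ([hermite_contradiction]).
    The integer I = sum_j l^j T(f^(j)), for f = G^(p-1) G' g^p, is of size at
    most K B^p because the exponential sum vanishes, while it is (p-1)! times
    l^(p-1) T(G' g)^p modulo p (p-1)!.  The Frobenius congruence for T replaces
    the customary product of conjugates of I: as soon as g satisfies
    T(G' g) <> 0 and p is large, I is nonzero, against (p-1)! > K B^p.

    Complex numbers enter only algebraically.  The functional T is nonzero, and
    the series of the T(X^k) / (l^k k!) has sum 0, because this series is the
    Cauchy product of the real series of the given relation with another one,
    of which only the real part matters ([choice_coefD1], [lindemann_core]). *)

(** * Powers modulo a prime *)

Section Frobenius.
Variables (A : comNzRingType) (p : nat).
Hypothesis p_prime : prime p.

Lemma exprD_prime (x y : A) : exists w, (x + y) ^+ p = x ^+ p + y ^+ p + w *+ p.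
Proof.
case: p p_prime => // n n_prime.
rewrite exprDn big_ord_recl big_ord_recr /= /bump /= add1n bin0 binn subn0 subnn.
rewrite !expr0 mulr1 mul1r !mulr1n.
set S := \sum_(i < _) _; suff [w ->] : exists w, S = w *+ n.+1.
  by exists w; rewrite [w *+ _ + _]addrC addrA.
rewrite {}/S; elim/big_ind: _ => [|_ _ [v ->] [w ->]|i _].
- by exists 0; rewrite mul0rn.
- by exists (v + w); rewrite mulrnDl.
have /dvdnP[k ->] : (n.+1 %| 'C(n.+1, 1 + i))%N by rewrite prime_dvd_bin //= add1n ltnS.
by eexists; rewrite mulrnA.
Qed.

Lemma expr_sum_prime (I : Type) (r : seq I) (F : I -> A) :
  exists w, (\sum_(i <- r) F i) ^+ p = \sum_(i <- r) F i ^+ p + w *+ p.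
Proof.
elim: r => [|i r [w IH]].
  by exists 0; rewrite !big_nil mul0rn addr0 expr0n gtn_eqF ?prime_gt0.
rewrite !big_cons; have [v ->] := exprD_prime (F i) (\sum_(j <- r) F j).
by exists (w + v); rewrite IH mulrnDl !addrA.
Qed.

(** Fermat's little theorem, deduced from the additivity of the p-th power by
    writing an integer as a sum of copies of 1 or of -1. *)
Lemma exprz_prime (c : int) : exists w, (c%:~R : A) ^+ p = c%:~R + w *+ p.
Proof.
have nat_case (u : A) n : (exists w, u ^+ p = u + w *+ p) ->
    exists w, (u *+ n) ^+ p = u *+ n + w *+ p.
  move=> [v up].
  have [w] := expr_sum_prime (index_iota 0 n) (fun=> u).
  rewrite !big_const_nat subn0 !iter_addr_0 => ->.
  by exists (v *+ n + w); rewrite up mulrnDl mulrnDl mulrnAC addrA.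
case: c => n; first by apply: nat_case; exists 0; rewrite expr1n mul0rn addr0.
rewrite NegzE mulrNz -mulNrn; apply: (nat_case (-1) n.+1).
have [p2|p_odd] := even_prime p_prime.
  by exists 1; rewrite p2 sqrrN expr1n mulr2n addrA addNr add0r.
by exists 0; rewrite -signr_odd p_odd expr1 mul0rn addr0.
Qed.

End Frobenius.

(** * Symmetrised exponential sums *)

Section Symmetrisation.
Variables (d : nat) (c : 'I_d -> int).
Local Notation choices := {ffun 'S_d -> 'I_d}.

(** Expanding the product over all permutations s of the sums
    sum_j c_j e^(x (s j)) amounts to choosing an index for each s: such a choice
    phi contributes the exponent [conj_sum x phi] with the coefficient
    [conj_weight phi]. *)
Definition conj_sum (V : nmodType) (x : 'I_d -> V) (phi : choices) : V :=
  \sum_(s : 'S_d) x (s (phi s)).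

Definition conj_weight (phi : choices) : int := \prod_(s : 'S_d) c (phi s).

(** The functional q |-> sum_phi b_phi q(delta_phi) attached to the expanded
    product.  Over a ring of multivariate polynomials with x the family of the
    indeterminates it is a symmetric polynomial. *)
Definition conj_trace (A : nzRingType) (x : 'I_d -> A) (q : {poly int}) : A :=
  \sum_phi (conj_weight phi)%:~R * (map_poly intr q).[conj_sum x phi].

(** Permuting the family x by t permutes the exponents of the expanded product
    in this way, and does not change their coefficients. *)
Definition shift_choice (t : 'S_d) (phi : choices) : choices :=
  [ffun s => phi (s * t^-1)%g].

Lemma shift_choice_bij t : bijective (shift_choice t).
Proof.
exists (shift_choice t^-1) => phi; apply/ffunP => s; rewrite !ffunE.
  by rewrite invgK mulgK.
by rewrite invgK mulgKV.
Qed.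

Lemma conj_weight_shift t phi : conj_weight (shift_choice t phi) = conj_weight phi.
Proof.
rewrite /conj_weight [RHS](reindex (fun s : 'S_d => (s * t^-1)%g)) /=.
  by apply: eq_bigr => s _; rewrite ffunE.
by exists (fun s => (s * t)%g) => s _; rewrite ?mulgK ?mulgKV.
Qed.

Lemma conj_sum_shift (V : nmodType) (x y : 'I_d -> V) (t : 'S_d) phi :
  y =1 x \o t -> conj_sum y phi = conj_sum x (shift_choice t phi).
Proof.
move=> yE; rewrite /conj_sum [RHS](reindex (fun s : 'S_d => (s * t)%g)) /=.
  by apply: eq_bigr => s _; rewrite ffunE mulgK permM yE.
by exists (fun s => (s * t^-1)%g) => s _; rewrite ?mulgK ?mulgKV.
Qed.

Lemma conj_sum_additive (A B : nmodType) (f : {additive A -> B}) (x : 'I_d -> A) y phi :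
  y =1 f \o x -> conj_sum y phi = f (conj_sum x phi).
Proof. by move=> yE; rewrite raddf_sum; apply: eq_bigr => s _; rewrite yE. Qed.

Lemma conj_trace_rmorph (A B : nzRingType) (f : {rmorphism A -> B})
    (x : 'I_d -> A) y q :
  y =1 f \o x -> conj_trace y q = f (conj_trace x q).
Proof.
move=> yE; rewrite rmorph_sum; apply: eq_bigr => phi _.
rewrite rmorphM rmorph_int (conj_sum_additive _ yE) -horner_map -map_poly_comp.
by congr (_ * _.[_]); apply: eq_map_poly => z /=; rewrite rmorph_int.
Qed.

Lemma conj_trace_shift (A : nzRingType) (x y : 'I_d -> A) (t : 'S_d) q :
  y =1 x \o t -> conj_trace y q = conj_trace x q.
Proof.
move=> yE; rewrite /conj_trace [RHS](reindex (shift_choice t)) /=; last first.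
  exact/onW_bij/shift_choice_bij.
by apply: eq_bigr => phi _; rewrite (conj_sum_shift _ yE) conj_weight_shift.
Qed.

(** The p-th power is additive modulo p, and fixes the integer weights. *)
Lemma conj_trace_Frobenius (A : comNzRingType) (x : 'I_d -> A) q p :
  prime p -> exists w : A, conj_trace x q ^+ p = conj_trace x (q ^+ p) + w *+ p.
Proof.
move=> p_pr; rewrite /conj_trace.
have [w ->] := expr_sum_prime p_pr (index_enum {ffun 'S_d -> 'I_d})
  (fun phi => (conj_weight phi)%:~R * (map_poly intr q).[conj_sum x phi]).
suff [v ->] : exists v, \sum_phi ((conj_weight phi)%:~R *
    (map_poly intr q).[conj_sum x phi]) ^+ p =
    \sum_phi (conj_weight phi)%:~R * (map_poly intr (q ^+ p)).[conj_sum x phi] + v *+ p.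
  by exists (v + w); rewrite mulrnDl addrA.
elim/big_ind2: _ => [|a a' b b' [v ->] [v' ->]|phi _].
- by exists 0; rewrite mul0rn addr0.
- by exists (v + v'); rewrite mulrnDl addrACA.
have [v cp] := exprz_prime A p_pr (conj_weight phi).
rewrite exprMn cp rmorphXn /= horner_exp.
exists (v * (map_poly intr q).[conj_sum x phi] ^+ p).
by rewrite mulrDl mulrnAl.
Qed.

Definition conj_poly (A : comNzRingType) (x : 'I_d -> A) : {poly A} :=
  \prod_(phi : choices) ('X - (conj_sum x phi)%:P).

Lemma conj_poly_shift (A : comNzRingType) (x y : 'I_d -> A) (t : 'S_d) :
  y =1 x \o t -> conj_poly y = conj_poly x.
Proof.
move=> yE; rewrite /conj_poly [RHS](reindex (shift_choice t)) /=; last first.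
  exact/onW_bij/shift_choice_bij.
by apply: eq_bigr => phi _; rewrite (conj_sum_shift _ yE).
Qed.

Lemma conj_poly_rmorph (A B : comNzRingType) (f : {rmorphism A -> B}) (x : 'I_d -> A) y :
  y =1 f \o x -> conj_poly y = map_poly f (conj_poly x).
Proof.
move=> yE; rewrite rmorph_prod; apply: eq_bigr => phi _.
by rewrite rmorphB /= map_polyX map_polyC (conj_sum_additive _ yE).
Qed.

End Symmetrisation.

(** * Integrality of symmetric values *)

Definition integer_valued (A : nzRingType) (x : A) : Prop := exists z : int, x = z%:~R.

Lemma integer_valued_sum (A : nzRingType) (I : Type) (r : seq I) (P : pred I)
    (F : I -> A) :
  (forall i, P i -> integer_valued (F i)) -> integer_valued (\sum_(i <- r | P i) F i).
Proof.
move=> F_int; apply: big_ind => [|_ _ [y ->] [z ->]|i /F_int //]; first by exists 0.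
by exists (y + z); rewrite intrD.
Qed.

Lemma integer_valued_mul (A : nzRingType) (x y : A) :
  integer_valued x -> integer_valued y -> integer_valued (x * y).
Proof. by move=> [u ->] [v ->]; exists (u * v); rewrite intrM. Qed.

Lemma integer_valued_exp (A : nzRingType) (x : A) n :
  integer_valued x -> integer_valued (x ^+ n).
Proof. by move=> [u ->]; exists (u ^+ n); rewrite rmorphXn. Qed.

Module SymmetricValues.
Import -(notations) mpoly.

Section Values.
Variables (C : numDomainType) (d : nat) (rho : 'I_d -> C).
Hypothesis rho_int : forall k, integer_valued (\prod_i ('X - (rho i)%:P))`_k.

Lemma mesym_value_int (k : 'I_d.+1) : integer_valued (mmap intr rho (mesym d int k)).
Proof.
have [z zE] := rho_int (d - k).
exists ((-1) ^+ k * z); rewrite intrM rmorphXn rmorphN1 -zE.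
have := mroots_coeff [tuple rho i | i < d] k.
rewrite big_tuple (eq_bigr (fun i => 'X - (rho i)%:P));
  last by move=> i _; rewrite tnth_mktuple.
move=> ->; rewrite mulrA -exprMn mulrNN mulr1 expr1n mul1r !mesymE !raddf_sum.
apply: eq_bigr => h _; rewrite /= mevalX mmapX /mmap1.
by apply: eq_bigr => i _; rewrite tnth_mktuple.
Qed.

(** By the fundamental theorem on symmetric polynomials: the elementary
    symmetric functions of the [rho i] are, up to sign, coefficients of
    the polynomial that has them as its roots. *)
Lemma sym_value_int (f : mpoly d int) :
  f \is symmetric -> integer_valued (mmap intr rho f).
Proof.
move=> /sym_fundamental[t [<- _]]; rewrite [comp_mpoly _ t]/mmap rmorph_sum /=.
apply: integer_valued_sum => m _; rewrite rmorphM /= mmapC.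
apply: integer_valued_mul; first by exists (mcoeff m t).
rewrite rmorph_prod /=; apply: big_ind => [|x y|i _]; first by exists 1.
  exact: integer_valued_mul.
rewrite rmorphXn; apply: integer_valued_exp; rewrite tnth_mktuple.
by apply: (mesym_value_int (lift ord0 i)).
Qed.

Let X (i : 'I_d) : mpoly d int := @mpolyX d int (mnm1 i).

Lemma msym_mpolyX (t : 'S_d) : X \o t =1 msym t \o X.
Proof. by move=> i /=; rewrite /msym mmapX mmap1U. Qed.

Lemma mmap_mpolyX : rho =1 mmap intr rho \o X.
Proof. by move=> i /=; rewrite mmapX mmap1U. Qed.

Variable c : 'I_d -> int.

Lemma conj_trace_sym q : conj_trace c X q \is symmetric.
Proof.
apply/issymP => t; rewrite -(conj_trace_rmorph _ _ (msym_mpolyX t)).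
exact: conj_trace_shift.
Qed.

Lemma conj_trace_int q : integer_valued (conj_trace c rho q).
Proof.
rewrite (conj_trace_rmorph _ _ mmap_mpolyX).
exact/sym_value_int/conj_trace_sym.
Qed.

(** The error term of the Frobenius congruence between multivariate polynomials
    is symmetric since p times it is, so that its value is an integer. *)
Lemma conj_trace_exp_prime q p : prime p ->
  exists w : int, conj_trace c rho q ^+ p = conj_trace c rho (q ^+ p) + w%:~R *+ p.
Proof.
move=> p_prime; have [w wE] := conj_trace_Frobenius c X q p_prime.
have wp_sym : w *+ p \is symmetric.
  have -> : w *+ p = conj_trace c X q ^+ p - conj_trace c X (q ^+ p).
    by rewrite wE addrC addKr.
  by rewrite rpredB ?rpredX ?conj_trace_sym.
have /sym_value_int[v vE] : w \is symmetric.
  apply/issymP => t; apply/mpolyP => m; apply/eqP.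
  rewrite -(eqr_pMn2r (prime_gt0 p_prime)) -!mcoeffMn -(issymP _ wp_sym t).
  by rewrite [msym t (w *+ p)]raddfMn.
exists v; rewrite -vE (conj_trace_rmorph _ _ mmap_mpolyX) -rmorphXn wE.
by rewrite rmorphD raddfMn /= -(conj_trace_rmorph _ _ mmap_mpolyX).
Qed.

Lemma conj_poly_int : exists2 G : {poly int}, G \is monic &
  map_poly intr G = conj_poly rho.
Proof.
have coef_int k : {z : int | (conj_poly rho)`_k = z%:~R}.
  apply/cid; rewrite (conj_poly_rmorph mmap_mpolyX) coef_map.
  apply/sym_value_int/issymP => t; rewrite -[LHS]coef_map.
  by rewrite -(conj_poly_rmorph (msym_mpolyX t)) (@conj_poly_shift _ _ X _ t).
pose G := \poly_(k < size (conj_poly rho)) sval (coef_int k).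
have GE : map_poly intr G = conj_poly rho.
  apply/polyP => k; rewrite coef_map coef_poly.
  case: ltnP => [_|/leq_sizeP->//]; by case: (coef_int k).
exists G => //; have: map_poly intr G \is (@monic C) by rewrite GE monic_prod_XsubC.
by rewrite !monicE (lead_coef_map_inj (@intr_inj C)) // => /eqP/(@intr_inj C _ 1)/eqP.
Qed.

End Values.
End SymmetricValues.

(** * Derivatives of powers *)

Section DerivativesOfPowers.
Variables (A : comNzRingType) (G : {poly A}).

Lemma deriv_expSM n h : (G ^+ n.+1 * h)^`() =
  G ^+ n * ((G^`() * h) *+ n.+1 + G * h^`()).
Proof.
rewrite derivM deriv_exp /= exprS mulrDr mulrnAl mulrnAr; congr (_ *+ _ + _).
  by rewrite -mulrA mulrCA.
by rewrite -mulrA mulrCA.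
Qed.

Lemma derivn_exp_lt n h j : (j < n)%N -> exists r, (G ^+ n * h)^`(j) = G * r.
Proof.
elim: j n h => [|j IH] [//|n] h ltjn; first by exists (G ^+ n * h); rewrite exprS mulrA.
by rewrite derivSn deriv_expSM; apply: IH.
Qed.

(** Modulo G, only the terms in which each of the n derivations hits a different
    factor G survive. *)
Lemma derivn_exp_eq n h :
  exists r, (G ^+ n * h)^`(n) = (G^`() ^+ n * h) *+ n`! + G * r.
Proof.
elim: n h => [|n IH] h; first by exists 0; rewrite mulr0 addr0 fact0.
rewrite derivSn deriv_expSM; have [r ->] := IH ((G^`() * h) *+ n.+1 + G * h^`()).
exists (r + (G^`() ^+ n * h^`()) *+ n`!).
rewrite mulrDr mulrnDl mulrnAr -mulrnA -factS mulrA -exprSr [G * (_ + _)]mulrDr.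
by rewrite -addrA [X in _ + X]addrC mulrnAr [G^`() ^+ n * (G * _)]mulrCA.
Qed.

End DerivativesOfPowers.

(** * A submultiplicative norm on integer polynomials *)

Section AbsolutePolynomial.
Variable (R : numDomainType).

(** The value at r >= 0 of this polynomial is the norm sum_i |f_i| r^i of f. *)
Definition abs_poly (f : {poly int}) : {poly R} := \poly_(i < size f) (`|f`_i|)%:~R.

Lemma coef_abs_poly f i : (abs_poly f)`_i = `|f`_i|%:~R.
Proof. by rewrite coef_poly; case: ltnP => // /leq_sizeP->. Qed.

Lemma horner_le_coef (p q : {poly R}) (x : R) :
  0 <= x -> (forall i, p`_i <= q`_i) -> p.[x] <= q.[x].
Proof.
move=> x_ge0 le_pq; pose m := maxn (size p) (size q).
rewrite (@horner_coef_wide _ m) ?leq_maxl // (@horner_coef_wide _ m q) ?leq_maxr //.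
by apply: ler_sum => i _; rewrite ler_wpM2r // exprn_ge0.
Qed.

Lemma abs_poly_ge0 f x : 0 <= x -> 0 <= (abs_poly f).[x].
Proof.
move=> x_ge0; have <- : (0 : {poly R}).[x] = 0 by rewrite horner0.
by apply: horner_le_coef => // i; rewrite coef0 coef_abs_poly ler0z.
Qed.

Lemma abs_polyM f g x : 0 <= x ->
  (abs_poly (f * g)).[x] <= (abs_poly f).[x] * (abs_poly g).[x].
Proof.
move=> x_ge0; rewrite -hornerM; apply: horner_le_coef => // i.
rewrite coef_abs_poly !coefM.
under [X in _ <= X]eq_bigr do rewrite !coef_abs_poly -intrM.
rewrite -(rmorph_sum (intmul (1 : R))) ler_int; apply: le_trans (ler_norm_sum _ _ _) _.
by apply: ler_sum => j _; rewrite normrM.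
Qed.

Lemma abs_polyX f n x : 0 <= x -> (abs_poly (f ^+ n)).[x] <= (abs_poly f).[x] ^+ n.
Proof.
move=> x_ge0; elim: n => [|n IH].
  rewrite !expr0 (_ : abs_poly 1 = 1) ?hornerC //.
  by apply/polyP => i; rewrite coef_abs_poly !coef1; case: (i == 0)%N.
rewrite !exprS; apply: le_trans (abs_polyM _ _ x_ge0) _.
by rewrite ler_wpM2l // abs_poly_ge0.
Qed.
End AbsolutePolynomial.

(** * Tails of exponential series *)

Section ExponentialBounds.
Variable R : realType.

Lemma exp_sum_bounded (x : R) : 0 <= x ->
  exists K, forall n, \sum_(k < n) x ^+ k / k`!%:R <= K.
Proof.
move=> x_ge0; exists (expR x) => n.
have -> : \sum_(k < n) x ^+ k / k`!%:R = series (exp_coeff x) n.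
  by rewrite /series /= big_mkord.
apply: nondecreasing_cvgn_le; last exact: is_cvg_series_exp_coeff.
by apply: nondecreasing_series => k _ _; apply: exp_coeff_ge0.
Qed.

(** A tail of a series of sum 0 dominated by the exponential series of D: since
    1 / (n + k)! <= 1 / (n! k!), the tail from the rank n on is at most C D^n / n!
    times the whole exponential series of D. *)
Lemma exp_tail_bound (a : nat -> R) (C D : R) : 0 <= C -> 0 <= D ->
  (forall k, `|a k| <= C * (D ^+ k / k`!%:R)) ->
  (forall eps : R, 0 < eps ->
     exists N, forall n, (N <= n)%N -> `|\sum_(k < n) a k| < eps) ->
  exists2 K, 0 <= K & forall n, `|\sum_(k < n) a k| <= K * (D ^+ n / n`!%:R).
Proof.
move=> C_ge0 D_ge0 a_le a_sum0; have [K leK] := exp_sum_bounded D_ge0.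
have K_ge0 : 0 <= K by apply: le_trans (leK 0%N); rewrite big_ord0.
have f_gt0 n : 0 < n`!%:R :> R by rewrite ltr0n fact_gt0.
have e_ge0 n : 0 <= D ^+ n / n`!%:R by rewrite divr_ge0 ?exprn_ge0 ?ler0n.
exists (C * K) => [|i]; first exact: mulr_ge0.
apply/ler_addgt0Pr => eps /a_sum0[N /(_ (i + N)%N (leq_addl _ _))].
rewrite big_split_ord /=; set s := \sum_(k < i) _; set S := \sum_(k < N) _ => small.
have S_le : `|S| <= C * K * (D ^+ i / i`!%:R).
  apply: le_trans (ler_norm_sum _ _ _) _.
  apply: (@le_trans _ _ (\sum_(k < N) C * (D ^+ i / i`!%:R) * (D ^+ k / k`!%:R))).
    apply: ler_sum => k _; apply: le_trans (a_le _) _; rewrite -mulrA ler_wpM2l //.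
    have -> : D ^+ i / i`!%:R * (D ^+ k / k`!%:R) = D ^+ (i + k) / (i`! * k`!)%:R.
      by rewrite exprD natrM invfM; ring.
    rewrite ler_wpM2l ?exprn_ge0 // lef_pV2 ?posrE ?ltr0n ?muln_gt0 ?fact_gt0 //.
    rewrite ler_nat -(bin_fact (leq_addr k i)) addKn.
    by rewrite leq_pmull // bin_gt0 leq_addr.
  rewrite -mulr_sumr [C * K * _]mulrAC; apply: ler_wpM2l (leK N).
  exact: mulr_ge0 (e_ge0 i).
have := ler_normB (s + S) S; rewrite addrK => /le_trans; apply.
by rewrite addrC lerD // ltW.
Qed.

(** The terms (2 B)^n / n! are bounded, hence B^n / n! is O(2^-n). *)
Lemma fact_dominates (C B : R) : 0 <= B ->
  exists N, forall n, (N <= n)%N -> C * B ^+ n < n`!%:R.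
Proof.
move=> B_ge0; have [K leK] := exp_sum_bounded (mulr_ge0 (ler0n R 2) B_ge0).
have [N ltN] : exists N : nat, C * K < N%:R.
  by exists (Num.bound `|C * K|); apply: le_lt_trans (ler_norm _) (archi_boundP _).
exists N => n leNn.
have n_gt0 : 0 < n`!%:R :> R by rewrite ltr0n fact_gt0.
have le1 : (2 * B) ^+ n / n`!%:R <= K.
  apply: le_trans (leK n.+1); rewrite big_ord_recr /= lerDr.
  by apply: sumr_ge0 => i _; rewrite divr_ge0 ?exprn_ge0 ?ler0n ?mulr_ge0.
rewrite ler_pdivrMr // exprMn in le1.
have lt2 : C * K < 2 ^+ n.
  apply: lt_le_trans ltN _; rewrite -natrX ler_nat.
  exact: leq_trans leNn (ltnW (ltn_expl n (isT : 1 < 2)%N)).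
have [C_le0|C_gt0] := leP C 0.
  by apply: le_lt_trans n_gt0; rewrite mulr_le0_ge0 ?exprn_ge0.
have p2 : 0 < 2 ^+ n :> R by rewrite exprn_gt0.
rewrite -(ltr_pM2l p2) mulrCA.
apply: (@le_lt_trans _ _ (C * (K * n`!%:R))); first by rewrite ler_pM2l.
by rewrite mulrA ltr_pM2r.
Qed.

End ExponentialBounds.

(** * Hermite's argument *)

Section Hermite.
Variables (R : realType) (T : {additive {poly int} -> int}) (l : int).
Hypothesis l_neq0 : l != 0.

Definition exp_partial (n : nat) : R :=
  \sum_(k < n) (T 'X^k)%:~R / (l%:~R ^+ k * k`!%:R).

(** The value of T on F = sum_j l^j f^(j), the polynomial that appears in
    Hermite's integral when the exponents are the points of T divided by l; the
    bound m only has to be at least the size of f. *)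
Definition hermite (m : nat) (f : {poly int}) : int :=
  \sum_(j < m) l ^+ j * T f^`(j).

Lemma additiveZ (z : int) g : T (z *: g) = z * T g.
Proof. by rewrite -{1}[z]intz scaler_int raddfMz -mulrzl intz. Qed.

Lemma hermite_add m f g : hermite m (f + g) = hermite m f + hermite m g.
Proof.
rewrite -big_split; apply: eq_bigr => j _ /=.
by rewrite derivnD raddfD mulrDr.
Qed.

(** The derivatives of X^i, divided by i!, are the terms of the truncation of the
    exponential series after the rank i. *)
Lemma hermiteXn m i : (i < m)%N ->
  (hermite m 'X^i)%:~R = l%:~R ^+ i * i`!%:R * exp_partial i.+1.
Proof.
move=> ltim; have l_unit : (l%:~R : R) != 0 by rewrite intr_eq0.
have -> : hermite m 'X^i = \sum_(j < i.+1) l ^+ j * T 'X^i^`(j).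
  rewrite /hermite -(big_mkord xpredT (fun j => l ^+ j * T 'X^i^`(j))).
  rewrite (big_cat_nat (n := i.+1)) //= big_mkord [X in _ + X]big_nat.
  rewrite [X in _ + X]big1 ?addr0 // => j /andP[ltij _].
  by rewrite derivnXn ffact_small // mulr0n raddf0 mulr0.
rewrite (reindex_inj rev_ord_inj) rmorph_sum mulr_sumr; apply: eq_bigr => j _ /=.
have leji : (j <= i)%N by rewrite -ltnS.
rewrite subSS derivnXn subKn // raddfMn rmorphM rmorphXn rmorphMn /=.
rewrite -mulr_natr -(ffact_fact (leq_subr j i)) subKn // natrM invfM.
have -> : l%:~R ^+ i = l%:~R ^+ (i - j) * l%:~R ^+ j :> R by rewrite -exprD subnK.
have jn0 : (j`!%:R : R) != 0 by rewrite pnatr_eq0 -lt0n fact_gt0.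
by field; rewrite jn0 expf_neq0.
Qed.

Lemma hermite_int m (f : {poly int}) : (size f <= m)%N ->
  (hermite m f)%:~R = \sum_(i < m) (f`_i)%:~R * (l%:~R ^+ i * i`!%:R * exp_partial i.+1).
Proof.
move=> le_f_m.
have hermiteMz (z : int) g : hermite m (z *: g) = z * hermite m g.
  rewrite mulr_sumr; apply: eq_bigr => j _.
  by rewrite derivnZ additiveZ mulrCA.
have -> : f = \sum_(i < m) f`_i *: 'X^i.
  rewrite -poly_def; apply/polyP => i; rewrite coef_poly.
  by case: ltnP => // /(leq_trans le_f_m)/leq_sizeP->.
have herm_sum (F : 'I_m -> {poly int}) : hermite m (\sum_i F i) = \sum_i hermite m (F i).
  apply: (big_morph _ (hermite_add m)).
  by apply: big1 => j _; rewrite linear0 raddf0 mulr0.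
rewrite herm_sum rmorph_sum; apply: eq_bigr => i _ /=.
by rewrite hermiteMz intrM hermiteXn // -poly_def coef_poly ltn_ord.
Qed.

Variables (C D : R).
Hypotheses (C_ge0 : 0 <= C) (D_ge0 : 0 <= D)
  (T_growth : forall n, `|T 'X^n|%:~R <= C * D ^+ n)
  (exp_partial_to0 : forall eps : R, 0 < eps ->
     exists N, forall n, (N <= n)%N -> `|exp_partial n| < eps).

Lemma exp_partial_tail : exists2 K, 0 <= K &
  forall i, i`!%:R * `|exp_partial i.+1| <= K * D ^+ i.
Proof.
have term_le k : `|(T 'X^k)%:~R / (l%:~R ^+ k * k`!%:R) : R| <= C * (D ^+ k / k`!%:R).
  have lk : 1 <= (`|l|%:~R : R) ^+ k by rewrite exprn_ege1 // ler1z -gtz0_ge1 normr_gt0.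
  have lk0 := lt_le_trans ltr01 lk.
  have fk : 0 < k`!%:R :> R by rewrite ltr0n fact_gt0.
  rewrite normrM normfV normrM normrX -!intr_norm normr_nat mulrA.
  rewrite ler_pM ?ler0z ?invr_ge0 ?mulr_ge0 ?(ltW lk0) ?(ltW fk) //.
  by rewrite lef_pV2 ?posrE ?mulr_gt0 // ler_peMl // ltW.
have [K K_ge0 tail] := exp_tail_bound C_ge0 D_ge0 term_le exp_partial_to0.
exists (K * D) => [|i]; first exact: mulr_ge0.
have f_gt0 n : 0 < n`!%:R :> R by rewrite ltr0n fact_gt0.
apply: le_trans (_ : i.+1`!%:R * `|exp_partial i.+1| <= _).
  by rewrite ler_wpM2r // ler_nat factS leq_pmull.
apply: le_trans (ler_wpM2l (ltW (f_gt0 _)) (tail i.+1)) _.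
by rewrite mulrC mulrA divfK ?gt_eqF // exprS mulrA.
Qed.

Lemma hermite_bound : exists2 K, 0 <= K & forall m (f : {poly int}), (size f <= m)%N ->
  `|hermite m f|%:~R <= K * (abs_poly R f).[`|l|%:~R * D].
Proof.
have [K K_ge0 tail] := exp_partial_tail; exists K => // m f le_fm.
rewrite intr_norm hermite_int //; apply: le_trans (ler_norm_sum _ _ _) _.
have le_am : (size (abs_poly R f) <= m)%N by apply: leq_trans le_fm; apply: size_poly.
rewrite (horner_coef_wide _ le_am) mulr_sumr; apply: ler_sum => i _.
rewrite coef_abs_poly !normrM normrX -!intr_norm normr_nat.
rewrite [leRHS]mulrCA ler_wpM2l ?ler0z // exprMn [leRHS]mulrCA -[leLHS]mulrA.
by rewrite ler_wpM2l ?exprn_ge0 ?ler0z.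
Qed.

Variables (G : {poly int}).
Hypotheses (T_vanish : forall h, T (G * h) = 0)
  (G_separable : exists u v N, N != 0 /\ u * G + v * G^`() = N%:P)
  (T_neq0 : exists h, T h != 0)
  (T_exp_prime : forall q p, prime p -> exists w : int, T q ^+ p = T (q ^+ p) + w *+ p).

(** The derivatives of order below p - 1 of G^(p-1) h are multiples of G, which T
    kills; that of order p - 1 is (p-1)! (G' g)^p modulo G; those of higher order
    have coefficients divisible by p!. *)
Lemma hermite_arith p g : prime p ->
  let f := G ^+ p.-1 * (G^`() * g ^+ p) in
  exists w : int, hermite (size f + p) f =
    (l ^+ p.-1 * T (G^`() * g) ^+ p + w *+ p) *+ p.-1`!.
Proof.
move=> p_prime f; have p_pred : p.-1.+1 = p by rewrite prednK ?prime_gt0.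
have [v vE] := T_exp_prime (G^`() * g) p_prime.
pose c := l ^+ p.-1 * T (G^`() * g) ^+ p.
have term j : exists w : int, l ^+ j * T f^`(j) =
    ((if j == p.-1 then c else 0) + w *+ p) *+ p.-1`!.
  case: ltngtP => [ltjp|ltpj|->].
  - have [r ->] := derivn_exp_lt G (G^`() * g ^+ p) ltjp.
    by exists 0; rewrite T_vanish mulr0 mul0rn addr0 mul0rn.
  - have lepj : (p <= j)%N by rewrite -p_pred.
    have /dvdnP[k jE] : (p`! %| j`!)%N by rewrite -(bin_fact lepj) dvdn_mull ?dvdn_mulr.
    exists (l ^+ j * T f^`N(j) *+ k); rewrite nderivn_def jE raddfMn add0r.
    by rewrite -{1}p_pred factS p_pred -!mulrnA mulrnAr; congr (_ *+ _); lia.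
  - have [r] := derivn_exp_eq G p.-1 (G^`() * g ^+ p); rewrite -/f => ->.
    exists (l ^+ p.-1 * - v); rewrite raddfD T_vanish addr0 raddfMn mulrnAr /c.
    rewrite [in LHS]mulrA -exprSr p_pred -exprMn; congr (_ *+ _).
    by rewrite -mulrnAr -mulrDr vE mulNrn addrK.
have {term} sum_term n : exists w : int, hermite n f =
    ((if (p.-1 < n)%N then c else 0) + w *+ p) *+ p.-1`!.
  elim: n => [|n [w IH]].
    by exists 0; rewrite /hermite big_ord0 mul0rn addr0 mul0rn.
  have [w' tE] := term n; exists (w + w').
  rewrite /hermite big_ord_recr -/(hermite n f) IH tE /= -mulrnDl; congr (_ *+ _).
  by rewrite ltnS mulrnDl addrACA; congr (_ + _); case: ltngtP; rewrite ?addr0 ?add0r.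
have [w ->] := sum_term (size f + p)%N; exists w.
by rewrite p_pred leq_addl.
Qed.

(** The functional T cannot annihilate the exponential series: the integer of
    [hermite_arith] is nonzero for large p, hence at least (p-1)! in absolute
    value, although [hermite_bound] makes it O(B^p).  The polynomial g comes from
    a Bezout relation between G and G': for h with T(h) <> 0,
    N h = u G h + v G' h gives T(G' (v h)) = N T(h). *)
Theorem hermite_contradiction : False.
Proof.
have [h Th] := T_neq0; have [u [v [N [N_neq0 bezout]]]] := G_separable.
pose t := T (G^`() * (v * h)).
have t_neq0 : t != 0.
  have : T (N *: h) != 0 by rewrite additiveZ mulf_neq0.
  rewrite -mul_polyC -bezout mulrDl raddfD -mulrA mulrCA T_vanish add0r /t.
  by rewrite mulrCA mulrA.
have [K K_ge0 bound] := hermite_bound.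
set x := `|l|%:~R * D in bound; have x_ge0 : 0 <= x by rewrite mulr_ge0 ?ler0z.
pose a := (abs_poly R G).[x]; pose b := (abs_poly R G^`()).[x].
pose e := (abs_poly R (v * h)).[x].
have [a_ge0 b_ge0 e_ge0] : [/\ 0 <= a, 0 <= b & 0 <= e] by rewrite !abs_poly_ge0.
have [N0 dom] := fact_dominates (K * b * e) (mulr_ge0 a_ge0 e_ge0).
have [p /andP[p_big p_prime]] : exists p, (N0 + `|l| + `|t| < p)%N && prime p.
  by have [p] := prime_above (N0 + `|l| + `|t|); exists p; apply/andP.
have p_pred : p.-1.+1 = p by rewrite prednK ?prime_gt0.
have le_N0 : (N0 <= p.-1)%N.
  by rewrite -ltnS p_pred (leq_ltn_trans _ p_big) // -addnA leq_addr.
have [w] := hermite_arith (v * h) p_prime.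
set f := G ^+ _ * _; rewrite -/t => hermE.
(* [dom] gives K b e (a e)^(p-1) < (p-1)!, where the left-hand side bounds the
   norm of f times K. *)
have := bound _ f (leq_addr p _); rewrite leNgt => /negP; apply.
have f_le : (abs_poly R f).[x] <= b * e * (a * e) ^+ p.-1.
  have -> : b * e * (a * e) ^+ p.-1 = a ^+ p.-1 * (b * e ^+ p).
    by rewrite -{3}p_pred exprMn exprS; ring.
  apply: le_trans (abs_polyM _ _ x_ge0) _.
  rewrite ler_pM ?abs_poly_ge0 ?abs_polyX //.
  apply: le_trans (abs_polyM _ _ x_ge0) _.
  by rewrite ler_pM ?abs_poly_ge0 ?abs_polyX.
apply: le_lt_trans (ler_wpM2l K_ge0 f_le) _; rewrite !mulrA.
apply: lt_le_trans (dom _ le_N0) _.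
rewrite hermE normrMn rmorphMn /= -[leLHS]mul1r mulr_natr lerMn2r; apply/orP; right.
rewrite ler1z -gtz0_ge1 normr_gt0.
apply/negP => /eqP eq0.
have : (p %| `|(l ^+ p.-1 * t ^+ p)%R|)%N.
  have -> : l ^+ p.-1 * t ^+ p = - w *+ p by apply/eqP; rewrite mulNrn -addr_eq0 eq0.
  by rewrite -mulr_natr abszM natz absz_nat dvdn_mull.
rewrite abszM !abszX Euclid_dvdM // !Euclid_dvdX //.
have ndvd (z : int) : z != 0 -> (`|z| < p)%N -> (p %| `|z|)%N = false.
  by move=> z_neq0 ltzp; apply: gtnNdvd; rewrite // absz_gt0.
by rewrite !ndvd //; move: p_big; rewrite ?addnA; lia.
Qed.
End Hermite.

(** * Products of exponential sums *)

Section LowCoefficient.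
Variable A : idomainType.

(** The order of vanishing of p at 0 is at most n; this bound is what survives
    when power series are replaced with their truncations. *)
Definition low_coef (n : nat) (p : {poly A}) := exists2 i, (i <= n)%N & p`_i != 0.

Lemma low_coefM m n p q : low_coef m p -> low_coef n q -> low_coef (m + n) (p * q).
Proof.
move=> [i0 lei p_i0] [j0 lej q_j0].
have [i p_i min_i] := ex_minnP (ex_intro (fun i => p`_i != 0) i0 p_i0).
have [j q_j min_j] := ex_minnP (ex_intro (fun j => q`_j != 0) j0 q_j0).
exists (i + j)%N.
  by rewrite leq_add // (leq_trans _ lei, leq_trans _ lej) ?min_i ?min_j.
have ltij : (i < (i + j).+1)%N by rewrite ltnS leq_addr.
rewrite coefM (bigD1 (Ordinal ltij)) //= addKn big1 ?addr0 ?mulf_neq0 // => k.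
rewrite -val_eqE /= neq_ltn => /orP[ltki|ltik].
  have -> : p`_k = 0 by apply: contraTeq ltki => /min_i; rewrite -leqNgt.
  by rewrite mul0r.
have -> : q`_(i + j - k) = 0; last by rewrite mulr0.
apply: contraTeq (ltn_ord k) => /min_j; rewrite -leqNgt; lia.
Qed.

Lemma low_coef_prod (I : Type) (r : seq I) (F : I -> {poly A}) n :
  (forall i, low_coef n (F i)) -> low_coef (n * size r) (\prod_(i <- r) F i).
Proof.
move=> F_low; elim: r => [|i r IH].
  by rewrite big_nil; exists 0%N; rewrite ?coef1 ?oner_eq0.
by rewrite big_cons mulnS; apply: low_coefM.
Qed.
End LowCoefficient.

Section ExponentialProducts.
Variable K : numFieldType.

(** The power series of z |-> e^(a z), truncated at the order N. *)
Definition exp_trunc (N : nat) (a : K) : {poly K} := \poly_(k < N) (a ^+ k / k`!%:R).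

Lemma coef_exp_trunc_prod (I : Type) (r : seq I) (P : pred I) (a : I -> K) N k :
  (k < N)%N ->
  (\prod_(i <- r | P i) exp_trunc N (a i))`_k = (\sum_(i <- r | P i) a i) ^+ k / k`!%:R.
Proof.
elim/big_ind2: _ k => [k _|p x q y px qy k ltkN|i _ k ltkN].
- by rewrite coef1 expr0n; case: k => [|k]; rewrite ?fact0 ?divr1 //= mul0r.
- rewrite coefMr exprDn mulr_suml; apply: eq_bigr => /= i _.
  have leik : (i <= k)%N by rewrite -ltnS.
  rewrite px ?qy ?(leq_ltn_trans _ ltkN) ?leq_subr //.
  have f_neq0 n : (n`!%:R : K) != 0 by rewrite pnatr_eq0 -lt0n fact_gt0.
  have b_neq0 : ('C(k, i)%:R : K) != 0 by rewrite pnatr_eq0 -lt0n bin_gt0.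
  rewrite -(bin_fact leik) -mulr_natr !natrM; field.
  by rewrite b_neq0 !f_neq0.
- by rewrite coef_poly ltkN.
Qed.

Variables (S J : finType) (c : J -> K) (x : S -> J -> K).

Definition factor N s : {poly K} := \sum_j c j *: exp_trunc N (x s j).

Lemma coef_factor N s k : (k < N)%N ->
  (factor N s)`_k = \sum_j c j * (x s j ^+ k / k`!%:R).
Proof.
by move=> ltkN; rewrite coef_sum; apply: eq_bigr => j _; rewrite coefZ coef_poly ltkN.
Qed.

(** The coefficient of z^k in the product, over the s satisfying P, of the power
    series sum_j c_j e^(x_s,j z), expanded; unlike that of the product of the
    truncations, it does not refer to an order of truncation.  Choices take
    the value j0 outside P, so that each family indexed by P is counted once. *)
Definition choice_coef (j0 : J) (P : pred S) k : K :=
  \sum_(phi in pffun_on j0 P predT)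
    (\prod_(s | P s) c (phi s)) * ((\sum_(s | P s) x s (phi s)) ^+ k / k`!%:R).

Lemma coef_prod_factor j0 P N k : (k < N)%N ->
  (\prod_(s | P s) factor N s)`_k = choice_coef j0 P k.
Proof.
move=> ltkN; rewrite (big_distr_big j0) coef_sum; apply: eq_bigr => phi _.
by rewrite scaler_prod coefZ coef_exp_trunc_prod.
Qed.

Lemma choice_coefT j0 k : choice_coef j0 predT k =
  \sum_(phi : {ffun S -> J}) (\prod_s c (phi s)) * ((\sum_s x s (phi s)) ^+ k / k`!%:R).
Proof.
apply: eq_bigl => phi; apply/pffun_onP; split=> //.
exact/fintype.subsetP.
Qed.

(** Singling out one factor s0 exhibits the full product as the Cauchy product of
    the series of that factor and of the product of all the others. *)
Lemma choice_coefD1 j0 s0 k : choice_coef j0 predT k =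
  \sum_(i < k.+1) (\sum_j c j * (x s0 j ^+ i / i`!%:R)) *
    choice_coef j0 (predC1 s0) (k - i).
Proof.
rewrite -(@coef_prod_factor _ _ k.+1) // (bigD1 s0) //= coefM; apply: eq_bigr => i _.
by rewrite coef_factor // -(@coef_prod_factor _ _ k.+1) // ltnS leq_subr.
Qed.

Lemma choice_coef_growth j0 P : exists C D : K, [/\ 0 <= C, 0 <= D &
  forall k, `|choice_coef j0 P k| <= C * (D ^+ k / k`!%:R)].
Proof.
pose b (phi : {ffun S -> J}) := \prod_(s | P s) c (phi s).
pose a (phi : {ffun S -> J}) := \sum_(s | P s) x s (phi s).
exists (\sum_phi `|b phi|), (\sum_phi `|a phi|); split; try exact: sumr_ge0.
move=> k; apply: le_trans (ler_norm_sum _ _ _) _.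
rewrite mulr_suml big_mkcond; apply: ler_sum => phi _.
have D_ge0 : 0 <= \sum_phi `|a phi| by exact: sumr_ge0.
have e_ge0 : 0 <= (\sum_phi `|a phi|) ^+ k / k`!%:R by rewrite divr_ge0 ?exprn_ge0 ?ler0n.
case: ifP => _; last by rewrite mulr_ge0.
rewrite -/(b phi) -/(a phi) normrM ler_wpM2l // normrM normfV normr_nat normrX.
rewrite ler_wpM2r ?invr_ge0 ?ler0n // lerXn2r ?nnegrE //.
by rewrite (bigD1 phi) //= lerDl sumr_ge0.
Qed.

(** Otherwise sum_j c_j q(x_j) = 0 for all polynomials q of degree below the
    number of points, in particular for the one that vanishes at all the points
    except x_j1. *)
Lemma power_sum_neq0 s j1 : injective (x s) -> c j1 != 0 ->
  exists2 k, (k < #|J|)%N & \sum_j c j * x s j ^+ k != 0.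
Proof.
move=> x_inj c_neq0; apply: contrapT => no_k.
pose roots_q := [seq x s j | j <- enum (predC1 j1)].
pose q := \prod_(z <- roots_q) ('X - z%:P).
have size_q : size q = #|J|.
  by rewrite size_prod_XsubC size_map -cardE cardC1 prednK //; apply/card_gt0P; exists j1.
have moment0 k : (k < #|J|)%N -> \sum_j c j * x s j ^+ k = 0.
  by move=> ltk; apply/eqP/negPn/negP => nz; apply: no_k; exists k.
have : \sum_j c j * q.[x s j] = 0.
  under eq_bigr do rewrite horner_coef mulr_sumr.
  rewrite exchange_big big1 //= => k _; rewrite size_q in k *.
  under eq_bigr do rewrite mulrCA.
  by rewrite -mulr_sumr moment0 ?mulr0.
rewrite (bigD1 j1) //= big1 ?addr0 => [/eqP|j nej]; last first.
  have /rootP-> : root q (x s j); last by rewrite mulr0.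
  by rewrite root_prod_XsubC map_f // mem_enum.
rewrite mulf_eq0 (negbTE c_neq0) -[_ == 0]/(root q (x s j1)) root_prod_XsubC.
by case/mapP => j; rewrite mem_enum => /negP nej /x_inj/eqP; rewrite eq_sym.
Qed.

(** A product of nonzero power series is nonzero.  Each factor has order less than
    the number of indices, so the order of the product is controlled and the
    product can be truncated beyond it. *)
Lemma choice_coef_neq0 j0 : (forall s, injective (x s)) -> (exists j, c j != 0) ->
  exists k, choice_coef j0 predT k != 0.
Proof.
move=> x_inj [j1 c_neq0]; pose N := (#|J| * #|S|).+1.
have leJN : (#|S| > 0 -> #|J| <= N)%N by rewrite /N => S_gt0; rewrite leqW // leq_pmulr.
have S_low s : low_coef #|J| (factor N s).
  have [k ltk nz] := power_sum_neq0 (x_inj s) c_neq0; exists k; first exact: ltnW.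
  rewrite coef_factor; last first.
    by apply: leq_trans ltk (leJN _); rewrite (cardD1 s).
  by under eq_bigr do rewrite mulrA; rewrite -mulr_suml mulf_neq0 // invr_neq0.
have [k lek nz] := low_coef_prod (index_enum S) S_low.
exists k; rewrite -(@coef_prod_factor _ _ N) // ltnS (leq_trans lek) //.
by rewrite leq_mul // -sum1_size sum1_card.
Qed.

End ExponentialProducts.

(** * Separable integer polynomials *)

Section Radical.

(** A root of p of multiplicity m > 0 has multiplicity m - 1 in the derivative, so
    a common divisor g of p and p' does not absorb it. *)
Lemma root_radical (F : numFieldType) (p q g : {poly F}) z :
  p != 0 -> p = q * g -> g %| p^`() -> root p z -> root q z.
Proof.
move=> p_neq0 pE g_dvd pz0; apply: contraT => qz_neq0.
have [m [w]] := multiplicity_XsubC p z; rewrite p_neq0 /= => wz_neq0 pw.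
have X_neq0 : 'X - z%:P != 0 :> {poly F} by rewrite polyXsubC_eq0.
case: m pw => [|m] pw; first by rewrite pw expr0 mulr1 (negbTE wz_neq0) in pz0.
have : ('X - z%:P) ^+ m.+1 %| g.
  rewrite -(@Gauss_dvdpr _ _ q) -?pE ?pw ?dvdp_mull //.
  by rewrite coprimep_expl // coprimep_sym coprimep_XsubC.
move=> /dvdp_trans/(_ g_dvd); rewrite pw derivM deriv_exp derivXsubC mul1r /=.
rewrite dvdp_addr; last exact: dvdp_mull.
rewrite exprS mulrnAr -mulrnAl dvdp_mul2r ?expf_neq0 //.
rewrite dvdp_XsubCl rootE hornerMn mulrn_eq0 /= -rootE.
by rewrite (negbTE wz_neq0).
Qed.

Lemma map_ratr_int (F : numFieldType) (P : {poly int}) :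
  map_poly ratr (map_poly intr P : {poly rat}) = map_poly intr P :> {poly F}.
Proof. by rewrite -map_poly_comp; apply: eq_map_poly => k /=; rewrite ratr_int. Qed.

Lemma root_scaled_int (F : numFieldType) (q : {poly rat}) (g : {poly int})
    (a : int) (z : F) :
  a != 0 -> q = a%:~R^-1 *: map_poly intr g ->
  root (map_poly (@ratr F) q) z = root (map_poly intr g) z.
Proof.
move=> a_neq0 ->; rewrite map_polyZ map_ratr_int rootZ //.
by rewrite fmorph_eq0 invr_eq0 intr_eq0.
Qed.

(** A common divisor over the integers remains one over the rationals, and keeps
    its degree. *)
Lemma coprimep_int (f g : {poly int}) :
  coprimep (map_poly intr f : {poly rat}) (map_poly intr g) -> coprimep f g.
Proof.
move=> /coprimepP coprime_fg; apply/coprimepP => h.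
have to_rat e : h %| e -> (map_poly intr h : {poly rat}) %| map_poly intr e.
  move=> /Pdiv.Idomain.dvdpP[[k r] /= k_neq0 ke].
  have kR : (k%:~R : rat) != 0 by rewrite intr_eq0.
  by rewrite -(dvdpZr _ _ kR) -map_polyZ ke rmorphM dvdp_mull.
move=> /to_rat hf /to_rat hg; have := coprime_fg _ hf hg.
by rewrite -!size_poly_eq1 size_map_inj_poly // => ? ? /intr_inj.
Qed.

(** Dividing G by the greatest common divisor of G and G' over the rationals, then
    clearing denominators. *)
Lemma int_radical (G : {poly int}) : G != 0 -> exists g : {poly int},
  [/\ separable_poly (map_poly intr g : {poly rat}),
      exists u v N, N != 0 /\ u * g + v * g^`() = N%:P &
      forall (F : numFieldType) (z : F),
        root (map_poly intr G) z -> root (map_poly intr g) z].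
Proof.
move=> G_neq0; pose p : {poly rat} := map_poly intr G.
have p_neq0 : p != 0 by rewrite map_poly_eq0_id0 // intr_eq0 lead_coef_eq0.
pose d := gcdp p p^`(); pose q := p %/ d.
have pE : p = q * d by rewrite divpK // dvdp_gcdl.
have [g [a a_neq0 qE]] := rat_poly_scale q.
have aR_neq0 : (a%:~R : rat) != 0 by rewrite intr_eq0.
have g_sep : separable_poly (map_poly intr g : {poly rat}).
  have /eqp_separable <- : q %= map_poly intr g.
    by rewrite qE eqp_scale // invr_eq0.
  exact: make_separable.
exists g; split=> //.
- have : coprimep g g^`().
    by apply: coprimep_int; rewrite -deriv_map; move: g_sep; rewrite unlock.
  move=> /Bezout_coprimepP[[u v] /=]; rewrite -size_poly_eq1.
  by move=> /size_poly1P[N N_neq0 bezout]; exists u, v, N.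
- move=> F z; rewrite -(root_scaled_int _ a_neq0 qE) -map_ratr_int -/p => pz.
  apply: (@root_radical _ _ _ (map_poly ratr d)) pz.
  + by rewrite map_poly_eq0.
  + by rewrite -rmorphM -pE.
  + by rewrite deriv_map dvdp_map dvdp_gcdr.
Qed.
End Radical.

(** * Cauchy products with a series of sum zero *)

Section Convolution.
Variable R : realType.

Lemma convolution_partial_sum (u g : nat -> R) n :
  \sum_(k < n) \sum_(i < k.+1) u i * g (k - i)%N =
  \sum_(j < n.+1) g j * \sum_(i < n - j) u i.
Proof.
elim: n => [|n IH]; first by rewrite big_ord0 big_ord1 /= big_ord0 mulr0.
rewrite big_ord_recr /= {}IH [RHS]big_ord_recr /= subnn big_ord0 mulr0 addr0.
rewrite [X in _ + X](reindex_inj rev_ord_inj) /= -big_split /=.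
apply: eq_bigr => j _.
have lejn : (j <= n)%N by rewrite -ltnS.
by rewrite !subSS subKn // subSn // big_ord_recr /= mulrDr [u _ * _]mulrC.
Qed.

(** Partial sums of the Cauchy product regroup as sums of a coefficient of g times
    a partial sum of u; the latter being a tail of a series of sum 0, the binomial
    formula bounds the whole by a multiple of (D + F)^n / n!. *)
Lemma convolution_to0 (u g : nat -> R) (C D E F : R) :
  0 <= C -> 0 <= D -> 0 <= E -> 0 <= F ->
  (forall k, `|u k| <= C * (D ^+ k / k`!%:R)) ->
  (forall k, `|g k| <= E * (F ^+ k / k`!%:R)) ->
  (forall eps : R, 0 < eps ->
     exists N, forall n, (N <= n)%N -> `|\sum_(k < n) u k| < eps) ->
  forall eps : R, 0 < eps -> exists N, forall n, (N <= n)%N ->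
    `|\sum_(k < n) \sum_(i < k.+1) u i * g (k - i)%N| < eps.
Proof.
move=> C_ge0 D_ge0 E_ge0 F_ge0 u_le g_le u_sum0 eps eps_gt0.
have [K K_ge0 tail] := exp_tail_bound C_ge0 D_ge0 u_le u_sum0.
have [N dom] := fact_dominates (E * K / eps) (addr_ge0 D_ge0 F_ge0).
exists N => n leNn; rewrite convolution_partial_sum.
have f_gt0 m : 0 < m`!%:R :> R by rewrite ltr0n fact_gt0.
apply: (@le_lt_trans _ _ (E * K * ((D + F) ^+ n / n`!%:R))); last first.
  have := dom n leNn; rewrite mulrAC ltr_pdivrMr // => lt_n.
  by rewrite mulrA ltr_pdivrMr // [eps * _]mulrC.
apply: le_trans (ler_norm_sum _ _ _) _; rewrite exprDn mulr_suml mulr_sumr.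
apply: ler_sum => j _; have lejn : (j <= n)%N by rewrite -ltnS.
rewrite normrM; apply: le_trans (ler_pM _ _ (g_le _) (tail _)) _ => //.
rewrite le_eqVlt; apply/orP; left; apply/eqP.
have f_neq0 m : (m`!%:R : R) != 0 by rewrite gt_eqF.
have b_neq0 : ('C(n, j)%:R : R) != 0 by rewrite pnatr_eq0 -lt0n bin_gt0.
rewrite -(bin_fact lejn) -mulr_natr !natrM; field.
by rewrite b_neq0 !f_neq0.
Qed.
End Convolution.

(** * Linear independence of exponentials *)

Section LindemannCore.
Variables (R : realType) (d : nat) (rho : 'I_d -> R[i]) (l : int) (c : 'I_d -> int).
Hypotheses (l_neq0 : l != 0) (rho_inj : injective rho)
  (rho_int : forall k, integer_valued (\prod_i ('X - (rho i)%:P))`_k)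
  (c_neq0 : exists j, c j != 0).
Local Notation C := R[i].

Definition int_trace (q : {poly int}) : int :=
  sval (cid (SymmetricValues.conj_trace_int rho_int c q)).

Lemma int_traceE q : (int_trace q)%:~R = conj_trace c rho q.
Proof. by rewrite /int_trace; case: cid. Qed.

Lemma int_trace_is_zmod_morphism : zmod_morphism int_trace.
Proof.
move=> f g; apply: (@intr_inj C); rewrite intrB !int_traceE -sumrB.
by apply: eq_bigr => phi _; rewrite rmorphB hornerD hornerN mulrBr.
Qed.

HB.instance Definition _ :=
  GRing.isZmodMorphism.Build _ _ int_trace int_trace_is_zmod_morphism.

Let coefC (j : 'I_d) : C := (c j)%:~R.
Let node (s : 'S_d) (j : 'I_d) : C := rho (s j) / l%:~R.

Lemma choice_coef_trace j0 k :
  choice_coef coefC node j0 predT k =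
    ((int_trace 'X^k)%:~R / (l%:~R ^+ k * k`!%:R) : R)%:C%C.
Proof.
rewrite rmorphM fmorphV rmorphM rmorphXn !rmorph_int rmorph_nat.
rewrite choice_coefT int_traceE /conj_trace mulr_suml; apply: eq_bigr => phi _.
rewrite rmorph_prod -mulrA; congr (_ * _).
by rewrite map_polyXn hornerXn -mulr_suml exprMn exprVn invfM mulrA.
Qed.

Lemma nonneg_complexE (z : C) : 0 <= z -> exists2 r : R, 0 <= r & z = r%:C%C.
Proof.
case: z => a b; rewrite lecE /= => /andP[/eqP b0 a_ge0].
by exists a => //; rewrite b0.
Qed.

Lemma choice_coef_growth_real j0 P : exists D E : R, [/\ 0 <= D, 0 <= E &
  forall k, `|choice_coef coefC node j0 P k| <= (D * (E ^+ k / k`!%:R))%:C%C].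
Proof.
have [D [E [/nonneg_complexE[D' D'_ge0 ->] /nonneg_complexE[E' E'_ge0 ->] le_choice]]] :=
  choice_coef_growth coefC node j0 P.
exists D', E'; split=> // k; apply: le_trans (le_choice k) _.
by rewrite rmorphM rmorphM rmorphXn fmorphV rmorph_nat.
Qed.

(** The hypothesis on v says that the relation between the exponentials of the
    rho_j / l holds and has real terms.  The factor of the identity permutation
    then has sum 0, hence so has the whole product by [convolution_to0]; as the
    full series and the first factor are real, the other factor may be replaced
    with its real part. *)
Lemma lindemann_core (v : nat -> R) (D E : R) :
  (forall k, \sum_j coefC j * (node 1%g j ^+ k / k`!%:R) = (v k)%:C%C) ->
  0 <= D -> 0 <= E -> (forall k, `|v k| <= D * (E ^+ k / k`!%:R)) ->
  (forall eps : R, 0 < eps ->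
     exists N, forall n, (N <= n)%N -> `|\sum_(k < n) v k| < eps) ->
  False.
Proof.
move=> vE D_ge0 E_ge0 v_le v_sum0; have [j0 cj0] := c_neq0.
have f_gt0 m : 0 < m`!%:R :> R by rewrite ltr0n fact_gt0.
have [D1 [E1 [D1_ge0 E1_ge0 full_le]]] := choice_coef_growth_real j0 predT.
have [D2 [E2 [D2_ge0 E2_ge0 rest_le]]] := choice_coef_growth_real j0 (predC1 1%g).
pose g k := complex.Re (choice_coef coefC node j0 (predC1 1%g) k).
have g_le k : `|g k| <= D2 * (E2 ^+ k / k`!%:R).
  by rewrite -lecR; apply: le_trans (normc_ge_Re _) (rest_le k).
have partialE n : exp_partial R int_trace l n =
    \sum_(k < n) \sum_(i < k.+1) v i * g (k - i)%N.
  apply: eq_bigr => k _.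
  have -> : (int_trace 'X^k)%:~R / (l%:~R ^+ k * k`!%:R) =
    complex.Re (choice_coef coefC node j0 predT k) :> R by rewrite choice_coef_trace.
  rewrite (choice_coefD1 _ _ _ 1%g) raddf_sum; apply: eq_bigr => i _.
  rewrite vE /g; case: (choice_coef _ _ _ _ _) => a b /=.
  by rewrite mul0r subr0.
have [G G_monic GE] := SymmetricValues.conj_poly_int rho_int.
have [r [_ r_sep r_root]] := int_radical (monic_neq0 G_monic).
apply: (@hermite_contradiction R int_trace l l_neq0 D1 (`|l|%:~R * E1) D1_ge0
  _ _ _ r) => //.
- by rewrite mulr_ge0 // ler0z.
- move=> n; have := le_trans (normc_ge_Re _) (full_le n).
  rewrite choice_coef_trace lecR /= normrM normfV normrM normrX normr_nat -!intr_norm.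
  have ln_gt0 : 0 < (`|l|%:~R : R) ^+ n by rewrite exprn_gt0 // ltr0z normr_gt0.
  rewrite ler_pdivrMr ?mulr_gt0 // => /le_trans; apply.
  rewrite exprMn le_eqVlt; apply/orP; left; apply/eqP.
  by field; rewrite gt_eqF.
- move=> eps eps_gt0.
  have [N small] := convolution_to0 D_ge0 E_ge0 D2_ge0 E2_ge0 v_le g_le v_sum0 eps_gt0.
  by exists N => n /small; rewrite partialE.
- move=> h; apply: (@intr_inj C); rewrite int_traceE /conj_trace big1 // => phi _.
  have /r_root/rootP : root (map_poly intr G) (conj_sum rho phi).
    rewrite GE rootE horner_prod; apply/prodf_eq0; exists phi => //.
    by rewrite hornerXsubC subrr.
  by move=> r0; rewrite rmorphM hornerM r0 mul0r mulr0.
- have [k nz] : exists k, choice_coef coefC node j0 predT k != 0.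
    apply: choice_coef_neq0; last by exists j0; rewrite intr_eq0.
    move=> s i j /(mulIf _)/rho_inj; rewrite invr_eq0 intr_eq0 => /(_ l_neq0).
    exact: perm_inj.
  exists 'X^k; apply: contraNneq nz => T0.
  by rewrite choice_coef_trace T0 mul0r rmorph0.
- move=> q p p_prime.
  have [w wE] := SymmetricValues.conj_trace_exp_prime rho_int c q p_prime.
  exists w; apply: (@intr_inj C).
  by rewrite rmorphXn rmorphD rmorphMn /= !int_traceE.
Qed.
End LindemannCore.

Lemma coef_comp_scaleX (A : comNzRingType) (p : {poly A}) (a : A) k :
  (p \Po (a *: 'X))`_k = a ^+ k * p`_k.
Proof.
rewrite comp_polyE.
under eq_bigr do rewrite exprZn scalerA mulrC.
by rewrite -(poly_def (size p) (fun i => a ^+ i * p`_i)) coef_poly;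
  case: ltnP => // /leq_sizeP->; rewrite ?mulr0.
Qed.

Lemma prod_XsubC_comp_scaleX (A : comNzRingType) (a : A) (r : seq A) :
  (\prod_(z <- r) ('X - (a * z)%:P)) \Po (a *: 'X) =
  a ^+ size r *: \prod_(z <- r) ('X - z%:P).
Proof.
elim: r => [|z r IH]; first by rewrite !big_nil -[1 in LHS]/1%:P comp_polyC scale1r.
rewrite !big_cons rmorphM /= IH rmorphB /= comp_polyX comp_polyC.
by rewrite polyCM mul_polyC -scalerBr -scalerAl -scalerAr scalerA exprS.
Qed.

(** The usual change of variable that makes the roots of an integer polynomial
    integral, by multiplying them by its leading coefficient. *)
Lemma scaled_roots_int (F : numFieldType) (g : {poly int}) (r : seq F) k :
  g != 0 -> map_poly intr g = (lead_coef g)%:~R *: \prod_(z <- r) ('X - z%:P) ->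
  integer_valued (\prod_(z <- r) ('X - ((lead_coef g)%:~R * z)%:P))`_k.
Proof.
rewrite -lead_coef_eq0; set l := lead_coef g => l_neq0 gE.
set Q := \prod_(z <- r) ('X - (l%:~R * z)%:P).
have lF_neq0 : (l%:~R : F) != 0 by rewrite intr_eq0.
have QE : Q = \prod_(z <- [seq l%:~R * z | z <- r]) ('X - z%:P) by rewrite big_map.
have size_Q : size Q = (size r).+1 by rewrite QE size_prod_XsubC size_map.
have [ltkd|] := ltnP k (size r); last first.
  rewrite leq_eqVlt => /orP[/eqP<-|ltdk]; last first.
    by exists 0; rewrite nth_default // size_Q.
  exists 1; have : Q \is monic by rewrite QE monic_prod_XsubC.
  by rewrite monicE lead_coefE size_Q => /eqP.
have := congr1 (fun p : {poly F} => p`_k) (prod_XsubC_comp_scaleX l%:~R r).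
rewrite coef_comp_scaleX -/Q coefZ -(subnKC (ltnW ltkd)).
rewrite exprD -mulrA => /(mulfI (expf_neq0 k lF_neq0)) ->.
have := congr1 (fun p : {poly F} => p`_k) gE; rewrite coefZ coef_map /= => lg.
exists (l ^+ (size r - k).-1 * g`_k); rewrite intrM rmorphXn lg mulrA -exprSr.
by rewrite prednK // subn_gt0.
Qed.

Section LindemannWeierstrass.
Variable R : realType.

Lemma int_annihilator (s : seq R) : (forall x, x \in s -> algebraic_number x) ->
  exists2 P : {poly int}, P != 0 & forall x, x \in s -> root (map_poly intr P) x.
Proof.
elim: s => [|x s IH] alg_s; first by exists 1; rewrite ?oner_eq0.
have [y s_y|P P_neq0 P_root] := IH; first by apply: alg_s; rewrite inE s_y orbT.
have [p p_neq0 px0] := alg_s x (mem_head x s).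
have [g [a a_neq0 pE]] := rat_poly_scale p.
rewrite (root_scaled_int _ a_neq0 pE) in px0.
exists (g * P) => [|y].
  rewrite mulf_neq0 //; apply: contraNneq p_neq0 => g0.
  by rewrite pE g0 rmorph0 scaler0.
by rewrite inE rmorphM rootM => /orP[/eqP->|/P_root->]; rewrite ?px0 ?orbT.
Qed.

Lemma exp_sum_cvg (s : seq R) (c : R -> int) :
  (fun n => \sum_(k < n) \sum_(x <- s) (c x)%:~R * (x ^+ k / k`!%:R)) @ \oo -->
  \sum_(x <- s) (c x)%:~R * expR x.
Proof.
elim: s => [|x s IH].
  rewrite big_nil (_ : (fun n => _) = cst 0); first exact: cvg_cst.
  by apply/funext => n; rewrite big1 // => k _; rewrite big_nil.
rewrite big_cons (_ : (fun n => _) = (fun n => (c x)%:~R * series (exp_coeff x) n +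
    \sum_(k < n) \sum_(x <- s) (c x)%:~R * (x ^+ k / k`!%:R))).
  apply: cvgD => //; apply: cvgMr; exact: is_cvg_series_exp_coeff.
apply/funext => n; rewrite /series /= big_mkord mulr_sumr -big_split /=.
by apply: eq_bigr => k _; rewrite big_cons.
Qed.

(** The exponents are among the roots of a separable integer polynomial, of
    leading coefficient l; the coefficients are extended by zero to the other
    roots, and the roots multiplied by l are those of a monic integer polynomial,
    as [lindemann_core] requires. *)
Theorem exp_lin_indep (s : seq R) (c : R -> int) : uniq s ->
  (forall x, x \in s -> algebraic_number x) ->
  \sum_(x <- s) (c x)%:~R * expR x = 0 -> forall x, x \in s -> c x = 0.
Proof.
move=> s_uniq s_alg exp0 x1 s_x1; apply: contrapT => /eqP c_neq0.
have [P P_neq0 P_root] := int_annihilator s_alg.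
have [g [g_sep _ g_root]] := int_radical P_neq0.
have g_neq0 : g != 0.
  apply: contraTneq g_sep => ->; apply/negP => /separable_poly_neq0.
  by rewrite rmorph0 eqxx.
have l_neq0 : lead_coef g != 0 by rewrite lead_coef_eq0.
have [r rE] := closed_field_poly_normal (map_poly intr g : {poly R[i]}).
rewrite (lead_coef_map_inj (@intr_inj R[i])) // in rE.
set l := lead_coef g in l_neq0 rE.
have lC_neq0 : (l%:~R : R[i]) != 0 by rewrite intr_eq0.
have r_uniq : uniq r.
  rewrite -separable_prod_XsubC -(eqp_separable (eqp_scale _ lC_neq0)) -rE.
  by rewrite -map_ratr_int separable_map.
have s_r x : x \in s -> x%:C%C \in r.
  move=> /P_root/g_root gx0; rewrite -root_prod_XsubC -(rootZ _ _ lC_neq0) -rE.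
  rewrite (_ : map_poly intr g = map_poly (real_complex R) (map_poly intr g)).
    by rewrite fmorph_root.
  by rewrite -map_poly_comp; apply: eq_map_poly => z /=; rewrite rmorph_int.
pose c' (z : R[i]) := if z \in [seq x%:C%C | x <- s] then c (complex.Re z) else 0.
have c'E (x : R) : x \in s -> c' x%:C%C = c x.
  by move=> s_x; rewrite /c' map_f.
have sumE (F : R[i] -> R[i]) : \sum_(i < size r) (c' r`_i)%:~R * F r`_i =
    \sum_(x <- s) (c x)%:~R * F x%:C%C.
  rewrite -(big_mkord xpredT (fun i => (c' r`_i)%:~R * F r`_i)).
  rewrite -(big_nth 0 xpredT (fun z => (c' z)%:~R * F z)).
  rewrite (bigID (mem [seq x%:C%C | x <- s])) /= [X in _ + X]big1 ?addr0; last first.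
    by move=> z /negbTE z_s; rewrite /c' z_s mul0r.
  rewrite -big_filter (perm_big [seq x%:C%C | x <- s]) /=; last first.
    apply: uniq_perm; rewrite ?filter_uniq // ?map_inj_uniq //; first exact: complexI.
    move=> z; rewrite mem_filter andb_idr // => /mapP[x s_x ->]; exact: s_r.
  by rewrite big_map; apply: eq_big_seq => x /c'E->.
pose v k := \sum_(x <- s) (c x)%:~R * (x ^+ k / k`!%:R).
apply: (@lindemann_core R (size r) (fun i => l%:~R * r`_i) l (fun i => c' r`_i) _ _ _ _
  v (\sum_(x <- s) `|(c x)%:~R|) (\sum_(x <- s) `|x|)) => //.
- by move=> i j /(mulfI lC_neq0)/eqP; rewrite nth_uniq // => /eqP/val_inj.
- move=> k; have := @scaled_roots_int R[i] g r k g_neq0 rE.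
  by rewrite (big_nth 0) big_mkord.
- have ltx : (index x1%:C%C r < size r)%N by rewrite index_mem s_r.
  by exists (Ordinal ltx); rewrite /= nth_index ?s_r // c'E.
- move=> k; rewrite rmorph_sum /=.
  under eq_bigr do rewrite perm1 mulrAC divff // mul1r.
  rewrite (sumE (fun z => z ^+ k / k`!%:R)); apply: eq_bigr => x _.
  by rewrite !rmorphM fmorphV rmorphXn rmorph_int rmorph_nat.
- exact: sumr_ge0.
- exact: sumr_ge0.
- move=> k; apply: le_trans (ler_norm_sum _ _ _) _; rewrite mulr_suml.
  rewrite big_seq [leRHS]big_seq; apply: ler_sum => x s_x.
  rewrite normrM ler_wpM2l // normrM normfV normr_nat normrX.
  rewrite ler_wpM2r ?invr_ge0 ?ler0n // lerXn2r ?nnegrE ?sumr_ge0 //.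
  by rewrite (big_rem x) //= lerDl sumr_ge0.
- move=> eps eps_gt0; have := @exp_sum_cvg s c; rewrite exp0.
  move=> /cvgrPdist_lt/(_ eps eps_gt0)[N _ small].
  by exists N => n leNn; have := small n leNn; rewrite sub0r normrN.
Qed.

End LindemannWeierstrass.

(** * Factorizations in reduced monoids *)

Lemma finite_bounded_seqs (T : choiceType) (D : set T) k : finite_set D ->
  finite_set [set s : seq T | (forall x, x \in s -> D x) /\ (size s <= k)%N].
Proof.
move=> D_fin; elim: k => [|k IH].
  apply: (sub_finite_set _ (finite_set1 [::])) => s [_].
  by rewrite leqn0 size_eq0 => /eqP.
apply: (sub_finite_set _ (_ : finite_set ([set [::]] `|`
   (fun p : T * seq T => p.1 :: p.2) @` (D `*` _)))); last first.
  rewrite finite_setU; split; first exact: finite_set1.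
  exact/finite_image/finite_setX/IH.
move=> [|x s] [sD les]; [by left | right; exists (x, s) => //; split => /=].
  by apply: sD; rewrite mem_head.
by split=> // y s_y; apply: sD; rewrite inE s_y orbT.
Qed.

Section ReducedMonoids.
Variables (T : choiceType) (idx : T) (op : Monoid.com_law idx) (H : set T).
Hypotheses (H_sub : submonoid op H)
  (H_reduced : forall u v, H u -> H v -> op u v = idx -> u = idx).

Lemma reduced_invertible u : invertible op H u -> u = idx.
Proof. by move=> [Hu [v Hv]]; apply: H_reduced. Qed.

Lemma atom_neq_idx a : atom op H a -> a != idx.
Proof.
case=> _ not_inv _; apply/eqP => aE; apply: not_inv.
by rewrite aE; split; [case: H_sub | exists idx; [case: H_sub | rewrite Monoid.mul1m]].
Qed.

Lemma submonoid_big (I : eqType) (r : seq I) (F : I -> T) :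
  (forall i, i \in r -> H (F i)) -> H (\big[op/idx]_(i <- r) F i).
Proof.
move=> HF; rewrite big_seq; apply: big_ind => [|x y|//]; by case: H_sub => ? ?; auto.
Qed.

Definition nontrivial_seq (b : T) (s : seq T) : Prop :=
  (forall a, a \in s -> H a /\ a != idx) /\ \big[op/idx]_(a <- s) a = b.

(** Unlike the BFM property it does not mention atoms, which makes it easy to
    transfer along homomorphisms; for reduced monoids both are equivalent. *)
Definition length_bounded : Prop :=
  forall b, H b -> exists N, forall s, nontrivial_seq b s -> (size s <= N)%N.

Lemma factorization_nontrivial b (z : multiset T) :
  factorizations op H b z -> nontrivial_seq b z.
Proof.
move=> [z_atom zE]; split=> // a /z_atom a_atom; split; last exact: atom_neq_idx.
by case: a_atom.
Qed.

Lemma seq_factorization b s : (forall a, a \in s -> atom op H a) ->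
  \big[op/idx]_(a <- s) a = b -> factorizations op H b (seq_mset s).
Proof.
move=> s_atom sE; split=> [a|]; last by rewrite (perm_big _ (perm_eq_seq_mset s)).
rewrite in_mset mset_seqE -has_count => /hasP[c s_c /eqP <-].
exact: s_atom.
Qed.

(** A longest decomposition into elements other than the identity consists of
    atoms. *)
Lemma length_bounded_factorization b : length_bounded -> H b ->
  exists2 s, (forall a, a \in s -> atom op H a) & \big[op/idx]_(a <- s) a = b.
Proof.
move=> bounded Hb; have [N leN] := bounded b Hb.
pose P n := `[< exists2 s, nontrivial_seq b s & size s = n >].
have [n0 Pn0] : exists n, P n.
  have [bE|b_neq] := eqVneq b idx.
    by exists 0%N; apply/asboolP; exists [::] => //; split => //; rewrite big_nil bE.
  exists 1%N; apply/asboolP; exists [:: b] => //; split; last by rewrite big_seq1.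
  by move=> a; rewrite inE => /eqP->.
have P_le n : P n -> (n <= N)%N by move=> /asboolP[s /leN les <-].
have [n /asboolP[s [s_nt sE] sn] n_max] := ex_maxnP (ex_intro P n0 Pn0) P_le.
exists s => // a s_a; have [Ha a_neq] := s_nt a s_a.
split=> // [/reduced_invertible/eqP|u v Hu Hv aE]; first by rewrite (negbTE a_neq).
have inv_idx : invertible op H idx.
  by split; [case: H_sub | exists idx; [case: H_sub | rewrite Monoid.mul1m]].
have [->|u_neq] := eqVneq u idx; first by left.
have [->|v_neq] := eqVneq v idx; first by right.
suff : P (size s).+1 by move=> /n_max; rewrite sn ltnn.
apply/asboolP; exists [:: u, v & rem a s]; last first.
  by rewrite /= size_rem // prednK // -has_predT; apply/hasP; exists a.
split; last first.
  rewrite !big_cons Monoid.mulmA -sE [RHS](big_rem a) //=.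
  exact: (congr1 (op^~ _) (esym aE)).
move=> c; rewrite !inE => /or3P[/eqP->|/eqP->|/mem_rem/s_nt] //.
Qed.

Lemma length_bounded_BFM : length_bounded -> BFM op H.
Proof.
move=> bounded b Hb; split.
  have [s s_atom sE] := length_bounded_factorization bounded Hb.
  by exists (size (seq_mset s)), (seq_mset s) => //; apply: seq_factorization.
have [N leN] := bounded b Hb; apply: (sub_finite_set _ (finite_II N.+1)) => n [z zb <-].
by apply: leN; apply: factorization_nontrivial.
Qed.

Lemma BFM_factorization b : BFM op H -> H b ->
  exists2 s, (forall a, a \in s -> atom op H a) & \big[op/idx]_(a <- s) a = b.
Proof. by move=> bfm /bfm[[_ [z [z_atom zE] _]] _]; exists (enum_mset z). Qed.

Lemma finite_nat_bounded (A : set nat) : finite_set A ->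
  exists N, forall n, A n -> (n <= N)%N.
Proof.
move=> /finite_seqP[r ->]; exists (\max_(n <- r) n) => n /= r_n.
exact: (leq_bigmax_seq n).
Qed.

(** Each element different from the identity factors into at least one atom. *)
Lemma BFM_length_bounded : BFM op H -> length_bounded.
Proof.
move=> bfm b Hb; have [_ /finite_nat_bounded[N leN]] := bfm b Hb; exists N.
have {leN} leN s : (forall a, a \in s -> atom op H a) ->
    \big[op/idx]_(a <- s) a = b -> (size s <= N)%N.
  move=> s_atom sE; have := seq_factorization s_atom sE => s_fact.
  rewrite -(perm_size (perm_eq_seq_mset s)); apply: leN.
  by exists (seq_mset s).
move=> s [s_nt sE].
suff [s' [s'_atom s'E les]] : exists s', [/\ forall a, a \in s' -> atom op H a,
    \big[op/idx]_(a <- s') a = b & (size s <= size s')%N].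
  exact: leq_trans les (leN _ s'_atom s'E).
elim: s b {Hb leN} s_nt sE => [|a s IH] b s_nt sE; first by exists [::].
have [|s' [s'_atom s'E les]] := IH _ _ erefl.
  by move=> c s_c; apply: s_nt; rewrite inE s_c orbT.
have [Ha a_neq] := s_nt a (mem_head a s).
have [r r_atom rE] := BFM_factorization bfm Ha.
exists (r ++ s'); split.
- by move=> c; rewrite mem_cat => /orP[/r_atom|/s'_atom].
- by rewrite big_cat rE s'E -sE big_cons.
rewrite size_cat /= -add1n leq_add // lt0n size_eq0.
by apply: contraNneq a_neq => r0; rewrite -rE r0 big_nil.
Qed.

Definition divisors_of (b : T) : set T := [set a | H a /\ exists2 c, H c & b = op a c].

(** The atoms in the factorizations of b are among its finitely many divisors, and
    the lengths of these factorizations are bounded. *)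
Lemma finite_divisors_FFM : BFM op H ->
  (forall b, H b -> finite_set (divisors_of b)) -> FFM op H.
Proof.
move=> bfm div_fin b Hb; split.
  by have [[_ [z zb _]] _] := bfm b Hb; exists z.
have [N leN] := BFM_length_bounded bfm Hb.
apply: (sub_finite_set _ (finite_image (@seq_mset T)
  (finite_bounded_seqs N (div_fin b Hb)))) => z zb.
exists (enum_mset z); last exact: seq_mset_id.
split; last exact/leN/factorization_nontrivial.
move=> a z_a; have [z_atom zE] := zb; have [Ha _ _] := z_atom a z_a.
split=> //; exists (\big[op/idx]_(c <- rem a (enum_mset z)) c).
  by apply: submonoid_big => c /mem_rem/z_atom[].
by rewrite -zE (big_rem a z_a).
Qed.

Lemma FFM_BFM : FFM op H -> BFM op H.
Proof.
move=> ffm b /ffm[[z zb] fin]; split; last exact: finite_image.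
by exists (size z), z.
Qed.

(** Every divisor is the product of a part of some factorization. *)
Lemma FFM_finite_divisors b : FFM op H -> H b -> finite_set (divisors_of b).
Proof.
move=> ffm Hb; have [_ fin] := ffm b Hb; have bfm := FFM_BFM ffm.
have [N leN] := BFM_length_bounded bfm Hb.
pose D : set T := \bigcup_(z in factorizations op H b) [set a | a \in z].
have D_fin : finite_set D.
  apply: bigcup_finite => // z _; apply/finite_seqP; exists (enum_mset z).
  by apply/seteqP; split => a.
apply: (sub_finite_set _ (finite_image (fun s : seq T => \big[op/idx]_(a <- s) a)
  (finite_bounded_seqs N D_fin))) => a [Ha [c Hc bE]].
have [r r_atom rE] := BFM_factorization bfm Ha.
have [s s_atom sE] := BFM_factorization bfm Hc.
have rs_fact : factorizations op H b (seq_mset (r ++ s)).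
  apply: seq_factorization; last by rewrite big_cat rE sE.
  by move=> e; rewrite mem_cat => /orP[/r_atom|/s_atom].
exists r => //; split.
  move=> e r_e; exists (seq_mset (r ++ s)) => //=.
  by rewrite (perm_mem (perm_eq_seq_mset (r ++ s))) mem_cat r_e.
apply: leq_trans (leN _ (factorization_nontrivial rs_fact)).
by rewrite (perm_size (perm_eq_seq_mset _)) size_cat leq_addr.
Qed.

End ReducedMonoids.

(** * Exponents of the elements of E(M) *)

Section ExponentSequences.
Variables (R : realType) (M : set R).
Hypotheses (M_positive : positive_monoid M)
  (M_algebraic : forall m, M m -> algebraic_number m).

Lemma M_0 : M 0. Proof. by case: M_positive => -[]. Qed.
Lemma M_add x y : M x -> M y -> M (x + y).
Proof. by case: M_positive => -[_ addM] _; apply: addM. Qed.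
Lemma M_nonneg x : M x -> 0 <= x. Proof. by case: M_positive => _; apply. Qed.

Definition exp_sum (s : seq R) : R := \sum_(x <- s) expR x.

Lemma exp_semiringP t : exp_semiring M t <->
  exists2 s : seq R, (forall x, x \in s -> M x) & t = exp_sum s.
Proof.
split; last first.
  move=> [s sM ->] N [[[N0 ND] _] N_exp].
  elim: s sM => [|x s IH] sM; first by rewrite /exp_sum big_nil.
  rewrite /exp_sum big_cons; apply: ND.
    by apply: N_exp; exists x => //; apply: sM; rewrite mem_head.
  by apply: IH => y s_y; apply: sM; rewrite inE s_y orbT.
pose X := [set t | exists2 s : seq R, (forall x, x \in s -> M x) & t = exp_sum s].
suff : exp_semiring M `<=` X by apply.
apply: smallest_sub => [|_ [m Mm <-]]; last first.
  exists [:: m]; last by rewrite /exp_sum big_seq1.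
  by move=> x; rewrite inE => /eqP->.
split; last by move=> _ [s _ ->] /=; apply: sumr_ge0 => x _; apply: expR_ge0.
split=> [|_ _ [s sM ->] [s' s'M ->]]; first by exists [::]; rewrite // /exp_sum big_nil.
exists (s ++ s'); last by rewrite /exp_sum big_cat.
by move=> x; rewrite mem_cat => /orP[/sM|/s'M].
Qed.

(** The difference of the multiplicities of each exponent is a coefficient of a
    relation between exponentials of distinct algebraic numbers. *)
Lemma exp_sum_unique (s s' : seq R) :
  (forall x, x \in s -> M x) -> (forall x, x \in s' -> M x) ->
  exp_sum s = exp_sum s' -> perm_eq s s'.
Proof.
move=> sM s'M /eqP; rewrite -subr_eq0 => /eqP eq0; apply/allP => x ss'_x /=.
pose c y : int := (count_mem y s)%:Z - (count_mem y s')%:Z.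
suff : c x = 0 by move=> /eqP; rewrite subr_eq0 => /eqP[->].
pose r := undup (s ++ s').
have r_x : x \in r by rewrite mem_undup.
have sumE (q : seq R) : {subset q <= r} ->
    exp_sum q = \sum_(y <- r) (count_mem y q)%:R * expR y.
  rewrite /exp_sum; elim: q => [|z q IH] q_r.
    by rewrite big_nil big1 // => y _; rewrite mul0r.
  rewrite big_cons IH => [|y q_y]; last by apply: q_r; rewrite inE q_y orbT.
  under [RHS]eq_bigr do rewrite /= natrD mulrDl.
  rewrite big_split /= [X in _ = X + _](bigD1_seq z) ?undup_uniq //=; last first.
    by apply: q_r; rewrite mem_head.
  congr (_ + _); rewrite eqxx mul1r big1 ?addr0 // => y;
    by rewrite eq_sym => /negbTE->; rewrite mul0r.
apply: (exp_lin_indep (undup_uniq (s ++ s'))) r_x => [y|].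
  by rewrite mem_undup mem_cat => /orP[/sM|/s'M]/M_algebraic.
rewrite -[RHS]eq0 (sumE s) ?(sumE s'); first last.
- by move=> y s_y; rewrite mem_undup mem_cat s_y.
- by move=> y s_y; rewrite mem_undup mem_cat s_y orbT.
rewrite -sumrB; apply: eq_bigr => y _.
by rewrite /c intrB mulrBl.
Qed.

(** Well defined up to permutation on E(M), by [exp_sum_unique]. *)
Definition exponents (t : R) : seq R :=
  match pselect (exists2 s : seq R, (forall x, x \in s -> M x) & t = exp_sum s) with
  | left ex => s2val (cid2 ex)
  | right _ => [::]
  end.

Local Notation S := (exp_semiring M `\ 0).

Lemma exponentsP t : S t ->
  [/\ forall x, x \in exponents t -> M x, t = exp_sum (exponents t) &
      exponents t != [::]].
Proof.
move=> [/exp_semiringP ex /eqP t_neq0]; rewrite /exponents; case: pselect => // ex'.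
case: cid2 => s sM tE /=; split=> //.
by apply: contra_neq t_neq0 => s0; rewrite tE s0 /exp_sum big_nil.
Qed.

Lemma exponents_perm t (s : seq R) : (forall x, x \in s -> M x) ->
  s != [::] -> t = exp_sum s ->
  S t /\ perm_eq s (exponents t).
Proof.
move=> sM s_neq tE.
have St : S t.
  split; first by apply/exp_semiringP; exists s.
  move=> /= t0; case: s s_neq sM tE => [//|x s] _ _ /eqP.
  rewrite t0 eq_sym gt_eqF // /exp_sum big_cons ltr_wpDr ?expR_gt0 //.
  by apply: sumr_ge0 => y _; apply: expR_ge0.
split=> //; have [tM tE' _] := exponentsP St.
by apply: exp_sum_unique => //; rewrite -tE -tE'.
Qed.

Definition sum_seq (s s' : seq R) : seq R := [seq x + y | x <- s, y <- s'].

Lemma exp_sumM s s' : exp_sum (sum_seq s s') = exp_sum s * exp_sum s'.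
Proof.
rewrite /exp_sum /sum_seq big_allpairs_dep mulr_suml; apply: eq_bigr => x _.
by rewrite mulr_sumr; apply: eq_bigr => y _; rewrite expRD.
Qed.

Lemma exponentsM t u : S t -> S u ->
  S (t * u) /\ perm_eq (sum_seq (exponents t) (exponents u)) (exponents (t * u)).
Proof.
move=> St Su; have [tM tE t_neq] := exponentsP St; have [uM uE u_neq] := exponentsP Su.
apply: exponents_perm; last by rewrite exp_sumM -tE -uE.
- by move=> _ /allpairsP[[x y] /= [/tM Mx /uM My ->]]; apply: M_add.
- by case: (exponents t) (exponents u) t_neq u_neq => [//|x s] [].
Qed.

Lemma exp_semiring_one : S 1.
Proof.
have [] := @exponents_perm 1 [:: 0] _ _ _ => //; last by rewrite /exp_sum big_seq1 expR0.
by move=> x; rewrite inE => /eqP->; apply: M_0.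
Qed.

Lemma exp_semiring_submonoid : @submonoid R 1 *%R S.
Proof.
by split; [exact: exp_semiring_one | move=> t u St Su; have [] := exponentsM St Su].
Qed.

Definition nb_exp t := size (exponents t).

Lemma nb_exp_gt0 t : S t -> (0 < nb_exp t)%N.
Proof. by move=> /exponentsP[_ _]; rewrite -size_eq0 -lt0n. Qed.

Lemma nb_expM t u : S t -> S u -> nb_exp (t * u) = (nb_exp t * nb_exp u)%N.
Proof.
by move=> St Su; have [_ /perm_size] := exponentsM St Su; rewrite size_allpairs.
Qed.

(** Exponents being nonnegative, the default 0 never exceeds them. *)
Definition max_exp t : R := \big[Order.max/0]_(x <- exponents t) x.

Lemma max_expP t : S t ->
  max_exp t \in exponents t /\ forall x, x \in exponents t -> x <= max_exp t.
Proof.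
move=> /exponentsP[tM _]; rewrite /max_exp; have := tM.
elim: (exponents t) => [//|x s IH] sM _; rewrite big_cons.
have Mx : M x by apply: sM; rewrite mem_head.
have [->|s_neq] := eqVneq s [::].
  rewrite big_nil max_l ?M_nonneg //; split; first by rewrite mem_head.
  by move=> y; rewrite inE => /eqP->.
have [y s_y|m_in m_max] := IH _ s_neq; first by apply: sM; rewrite inE s_y orbT.
split; first by rewrite maxEle; case: ifP => _; rewrite inE ?m_in ?eqxx ?orbT.
by move=> y; rewrite inE le_max => /orP[/eqP->|/m_max->]; rewrite ?lexx ?orbT.
Qed.

Lemma max_exp_in t : S t -> M (max_exp t).
Proof.
by move=> St; have [tM _ _] := exponentsP St; apply/tM; have [] := max_expP St.
Qed.

Lemma max_expM t u : S t -> S u -> max_exp (t * u) = max_exp t + max_exp u.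
Proof.
move=> St Su; have [Stu /perm_mem tuE] := exponentsM St Su.
have [t_in t_max] := max_expP St; have [u_in u_max] := max_expP Su.
have [tu_in tu_max] := max_expP Stu; apply/le_anti/andP; split.
  move: tu_in; rewrite -tuE => /allpairsP[[x y] /= [tx uy ->]].
  by rewrite lerD ?t_max ?u_max.
by apply: tu_max; rewrite -tuE; apply: allpairs_f.
Qed.

Lemma max_nb_exp_eq1 t : S t -> max_exp t = 0 -> nb_exp t = 1%N -> t = 1.
Proof.
move=> St; have [_ tE _] := exponentsP St; have [+ _] := max_expP St.
rewrite /nb_exp => top_in top0; move: top_in; rewrite {}top0.
case: (exponents t) tE => [|x []] //= tE; rewrite inE => /eqP x0 _.
by rewrite tE /exp_sum big_seq1 -x0 expR0.
Qed.

Lemma exp_semiring_ge1 t : S t -> 1 <= t.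
Proof.
move=> /exponentsP[tM tE]; case: (exponents t) tM tE => [//|x s] tM -> _.
rewrite /exp_sum big_cons; apply: (@le_trans _ _ (expR x)).
  by rewrite -expR0 ler_expR; apply/M_nonneg/tM; rewrite mem_head.
by rewrite lerDl; apply: sumr_ge0 => y _; apply: expR_ge0.
Qed.

Lemma exp_semiring_reduced t u : S t -> S u -> t * u = 1 -> t = 1.
Proof.
move=> /exp_semiring_ge1 t1 /exp_semiring_ge1 u1 tu1.
apply/le_anti; rewrite t1 andbT -tu1.
by rewrite ler_peMr // (le_trans ler01).
Qed.

Lemma M_submonoid : @submonoid R 0 +%R M.
Proof. by case: M_positive. Qed.

(** * Transfer of the chain and factorization properties *)

(** Write b_n = b_(n+1) t_n.  The principal ideals of M generated by the largest
    exponents of the b_n form an ascending chain, and the numbers of exponents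
    are nonincreasing; once both are constant, t_n has largest exponent 0 and a
    single exponent, so t_n = 1. *)
Lemma semiring_ACCP_of_ACCP : @ACCP R 0 +%R M -> semiring_ACCP (exp_semiring M).
Proof.
move=> accp I I_principal I_sub.
have [b Sb IE] : exists2 b : nat -> R, forall n, S (b n) &
    forall n, I n = @principal_ideal R 1 *%R S (b n).
  have ex n : {x | S x /\ I n = @principal_ideal R 1 *%R S x}.
    by apply/cid; have [x Sx Ix] := I_principal n; exists x.
  by exists (fun n => sval (ex n)) => n; case: (ex n) => x [].
have b_factor n : exists2 t, S t & b n = b n.+1 * t.
  have : I n.+1 (b n).
    by apply: I_sub; rewrite IE; exists 1; [exact: exp_semiring_one | exact: mulr1].
  by rewrite IE => -[t St tE]; exists t => //; rewrite -[LHS]tE.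
have step n : max_exp (b n.+1) = max_exp (b n) ->
    nb_exp (b n.+1) = nb_exp (b n) -> b n.+1 = b n.
  have [t St tE] := b_factor n; rewrite tE max_expM // nb_expM // => /eqP.
  rewrite -subr_eq0 opprD addNKr oppr_eq0 => /eqP top0 count1.
  rewrite (max_nb_exp_eq1 St top0) ?mulr1 //.
  by apply/eqP; rewrite -(eqn_pmul2l (nb_exp_gt0 (Sb n.+1))) -count1 muln1.
have [N1 max_const] : exists N, forall n, (N <= n)%N ->
    max_exp (b n.+1) = max_exp (b n).
  have [n|n _ [m Mm <-]|N NE] := accp (fun n => @principal_ideal R 0 +%R M (max_exp (b n))).
  - by exists (max_exp (b n)) => //; apply: max_exp_in.
  - have [t St tE] := b_factor n; exists (max_exp t + m).
      exact/M_add/Mm/max_exp_in.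
    by rewrite tE max_expM //; exact: addrA.
  exists N => n leNn; apply/le_anti/andP; split.
    have [t St ->] := b_factor n; rewrite max_expM // lerDl; exact/M_nonneg/max_exp_in.
  have : @principal_ideal R 0 +%R M (max_exp (b n)) (max_exp (b n.+1)).
    rewrite (NE n leNn) -(NE n.+1 (leqW leNn)).
    by exists 0; [exact: M_0 | exact: addr0].
  by move=> [m Mm <-]; rewrite lerDl; apply: M_nonneg.
have [N2 count_const] : exists N, forall n, (N <= n)%N ->
    nb_exp (b n.+1) = nb_exp (b n).
  have count_le n : (nb_exp (b n.+1) <= nb_exp (b n))%N.
    have [t St ->] := b_factor n; rewrite nb_expM // leq_pmulr //; exact: nb_exp_gt0.
  have count_mono m n : (m <= n)%N -> (nb_exp (b n) <= nb_exp (b m))%N.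
    move=> /subnK <-; elim: (n - m)%N => // k IH; exact: leq_trans (count_le _) IH.
  have ex : exists k, `[< exists n, nb_exp (b n) = k >].
    by exists (nb_exp (b 0)); apply/asboolP; exists 0%N.
  have [k /asboolP[N kE] k_min] := ex_minnP ex.
  have eq_k n : (N <= n)%N -> nb_exp (b n) = k.
    move=> leNn; apply/eqP; rewrite eqn_leq -{1}kE count_mono //=.
    by apply: k_min; apply/asboolP; exists n.
  by exists N => n leNn; rewrite !eq_k // leqW.
exists (N1 + N2)%N => n /subnK <-; elim: (n - _)%N => // k IH.
rewrite addSn -{}IH !IE step //.
  by apply: max_const; rewrite addnCA leq_addr.
by apply: count_const; rewrite addnA leq_addl.
Qed.

(** The factors with a positive largest exponent yield a decomposition in M of the
    largest exponent of b.  Each of the other factors different from 1 has at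
    least two exponents, so that with k of them b has at least 2^k exponents. *)
Lemma length_bounded_exp_semiring : length_bounded +%R M -> @length_bounded R 1 *%R S.
Proof.
move=> bounded b Sb; have [N leN] := bounded (max_exp b) (max_exp_in Sb).
exists (N + nb_exp b)%N => s [s_nt sE].
have : [/\ max_exp b = \sum_(a <- s) max_exp a &
    nb_exp b = (\prod_(a <- s) nb_exp a)%N].
  rewrite -sE; elim: s {sE} s_nt => [|a s IH] s_nt.
    rewrite !big_nil; have := max_expM exp_semiring_one exp_semiring_one.
    have := nb_expM exp_semiring_one exp_semiring_one; rewrite mulr1.
    move=> c11 /eqP; rewrite -subr_eq0 opprD addNKr oppr_eq0 => /eqP; split=> //.
    by apply/eqP; rewrite -(eqn_pmul2l (nb_exp_gt0 exp_semiring_one)) -c11 muln1.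
  have [Sa _] := s_nt a (mem_head a s).
  have {}s_nt c : c \in s -> S c /\ c != 1.
    by move=> s_c; apply: s_nt; rewrite inE s_c orbT.
  have [topE countE] := IH s_nt; rewrite !big_cons max_expM ?nb_expM ?topE ?countE //.
  - by apply: (submonoid_big exp_semiring_submonoid) => c /s_nt[].
  - by apply: (submonoid_big exp_semiring_submonoid) => c /s_nt[].
move=> [topE countE].
rewrite -(count_predC (fun a => max_exp a != 0) s) leq_add //.
  rewrite -size_filter -(size_map (@max_exp)); apply: leN; split.
    move=> _ /mapP[a + ->]; rewrite mem_filter => /andP[top_neq /s_nt[Sa _]].
    by split => //; apply: max_exp_in.
  rewrite big_map big_filter topE [RHS](bigID (fun a => max_exp a != 0)) /=.
  by rewrite [X in _ + X]big1 ?addr0 // => a /negbNE/eqP.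
rewrite countE; apply: (@leq_trans (2 ^ count (predC (fun a => max_exp a != 0)) s)).
  exact/ltnW/ltn_expl.
elim: s s_nt {sE topE countE} => [|a s IH] s_nt; first by rewrite big_nil.
have [Sa a_neq] := s_nt a (mem_head a s).
rewrite big_cons /= expnD leq_mul //; last first.
  by apply: IH => c s_c; apply: s_nt; rewrite inE s_c orbT.
case: eqVneq => [top0|_] /=; last exact: nb_exp_gt0.
rewrite expn1 ltn_neqAle nb_exp_gt0 // andbT; apply: contraNneq a_neq => one.
by rewrite (max_nb_exp_eq1 Sa top0 (esym one)).
Qed.

Lemma BFS_of_BFM : @BFM R 0 +%R M -> BFS (exp_semiring M).
Proof.
move=> /BFM_length_bounded/length_bounded_exp_semiring.
exact: (length_bounded_BFM exp_semiring_submonoid exp_semiring_reduced).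
Qed.

(** If b = t u, adding any exponent of u to an exponent x of t yields an exponent
    of b, so x is among the finitely many divisors of the exponents of b; and t
    has at most as many exponents as b. *)
Lemma FFS_of_FFM : @FFM R 0 +%R M -> FFS (exp_semiring M).
Proof.
move=> ffm; have bfm := FFM_BFM ffm.
apply: (finite_divisors_FFM exp_semiring_submonoid (BFS_of_BFM bfm)) => b Sb.
have [bM bE b_neq] := exponentsP Sb.
pose D : set R := \bigcup_(z in [set z | z \in exponents b]) divisors_of +%R M z.
have D_fin : finite_set D.
  apply: bigcup_finite => [|z /bM Mz]; first by apply/finite_seqP; exists (exponents b).
  exact: (FFM_finite_divisors M_submonoid ffm Mz).
apply: (sub_finite_set _ (finite_image exp_sum (finite_bounded_seqs (nb_exp b) D_fin))).
move=> t [St [u Su tuE]]; have [tM tE t_neq] := exponentsP St.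
have [uM uE u_neq] := exponentsP Su; exists (exponents t) => //; split; last first.
  by rewrite tuE nb_expM // leq_pmulr // nb_exp_gt0.
move=> x t_x; have [y u_y] : exists y, y \in exponents u.
  by case: (exponents u) u_neq => // y s _; exists y; rewrite mem_head.
exists (x + y); last by split; [exact: tM | exists y => //; exact: uM].
rewrite /= tuE; have [_ /perm_mem <-] := exponentsM St Su.
exact: allpairs_f.
Qed.

End ExponentSequences.

Theorem proposition4p1 (R : realType) (M : set R)
    (M_positive : positive_monoid M)
    (M_algebraic : forall m, M m -> algebraic_number m) :
  [/\ @ACCP R 0 +%R M -> semiring_ACCP (exp_semiring M),
      @BFM R 0 +%R M -> BFS (exp_semiring M) &
      @FFM R 0 +%R M -> FFS (exp_semiring M)].
Proof.
split.
- exact: semiring_ACCP_of_ACCP.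
- exact: BFS_of_BFM.
- exact: FFS_of_FFM.
Qed.
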